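(* Let $M>0$ and let $f:[0,1]\to\mathbb{R}$ be an ignition-type nonlinearity (see context). For $l>0$ let $D=\mathbb{R}\times[-\pi l,\pi l]$ and let $u=u_l=\nabla^\perp h_l=(\partial_y h_l,-\partial_x h_l)$ with $h_l(x,y)=l\sin\frac{x}{l}\sin\frac{y}{l}$. For $A\in\mathbb{R}$ let $T(t,x,y)$ be the solution of $$T_t+A\,u(x,y)\cdot\nabla T=\Delta T+Mf(T),\qquad T(0,x,y)=T_0(x,y),$$ on $D$, with $T(t,x,y)=T(t,x,y+2\pi l)$ and $T(t,x,y)\to0$ as $x\to\pm\infty$, where the initial datum satisfies $0\le T_0\le 1$ and $T_0(x,y)=1$ for $(x,y)\in[0,\pi l]\times[0,\pi l]$. Then there exists a critical cell size $l_0$ with $C_1M^{-1/2}\le l_0\le C_2M^{-1/2}$, where $C_1,C_2$ are positive constants not depending on $M$ or $A$, such that if $l\ge l_0$ then $T(t,x,y)\to1$ as $t\to+\infty$, uniformly on compact sets, for every $A\in\mathbb{R}$.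
   Context: The nonlinearity $f$ is of ignition type: (i) $f$ is Lipschitz continuous on $[0,1]$; (ii) $f(1)=0$ and there is $\theta_0\in(0,1)$ with $f(T)=0$ for $T\in[0,\theta_0]$ and $f(T)>0$ for $T\in(\theta_0,1)$; (iii) $f(T)\le T$. The paper describes $C_1,C_2$ as universal positive constants (the notation $l_0\sim M^{-1/2}$). *)

(* Defs.v *)
From Stdlib Require Export Reals.
Open Scope R_scope.

Definition ignition (f : R -> R) : Prop :=
  (exists L : R, forall a b, 0 <= a <= 1 -> 0 <= b <= 1 ->
      Rabs (f a - f b) <= L * Rabs (a - b)) /\
  f 1 = 0 /\
  (exists th0 : R, 0 < th0 < 1 /\
     (forall s, 0 <= s <= th0 -> f s = 0) /\
     (forall s, th0 < s < 1 -> f s > 0)) /\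
  (forall s, 0 <= s <= 1 -> f s <= s).

Definition h_l (l x y : R) : R := l * sin (x / l) * sin (y / l).

(* u = grad^perp h_l = (d_y h_l, - d_x h_l), computed explicitly. *)
Definition u1 (l x y : R) : R := sin (x / l) * cos (y / l).
Definition u2 (l x y : R) : R := - (cos (x / l) * sin (y / l)).

Definition cont3 (g : R -> R -> R -> R) (t x y : R) : Prop :=
  forall eps, 0 < eps -> exists delta, 0 < delta /\
    forall t' x' y', Rabs (t' - t) < delta -> Rabs (x' - x) < delta ->
      Rabs (y' - y) < delta -> Rabs (g t' x' y' - g t x y) < eps.

Definition cont2 (g : R -> R -> R) (x y : R) : Prop :=
  forall eps, 0 < eps -> exists delta, 0 < delta /\
    forall x' y', Rabs (x' - x) < delta -> Rabs (y' - y) < delta ->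
      Rabs (g x' y' - g x y) < eps.

(* T is a classical solution (for t > 0) of
     T_t + A u . grad T = Delta T + M f(T)
   on R x R, 2*pi*l-periodic in y (equivalently on D = R x [-pi l, pi l]
   with periodic conditions), T -> 0 as x -> +-oo, with initial datum T0
   attained at every point of continuity of T0 with |y| < pi l. *)
Definition is_solution (M : R) (f : R -> R) (l A : R)
    (T0 : R -> R -> R) (T : R -> R -> R -> R) : Prop :=
  (forall t x y, 0 < t -> 0 <= T t x y <= 1) /\
  (forall t x y, 0 < t -> T t x (y + 2 * PI * l) = T t x y) /\
  (forall t y, 0 < t -> forall eps, 0 < eps -> exists X, forall x,
      X < Rabs x -> Rabs (T t x y) < eps) /\
  (exists Tt Tx Ty Txx Tyy : R -> R -> R -> R,
     forall t x y, 0 < t ->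
       derivable_pt_lim (fun s => T s x y) t (Tt t x y) /\
       derivable_pt_lim (fun z => T t z y) x (Tx t x y) /\
       derivable_pt_lim (fun z => T t x z) y (Ty t x y) /\
       derivable_pt_lim (fun z => Tx t z y) x (Txx t x y) /\
       derivable_pt_lim (fun z => Ty t x z) y (Tyy t x y) /\
       cont3 T t x y /\ cont3 Tt t x y /\ cont3 Tx t x y /\ cont3 Ty t x y /\
       cont3 Txx t x y /\ cont3 Tyy t x y /\
       Tt t x y + A * (u1 l x y * Tx t x y + u2 l x y * Ty t x y)
         = Txx t x y + Tyy t x y + M * f (T t x y)) /\
  (forall x y, - (PI * l) < y < PI * l -> cont2 T0 x y ->
     forall eps, 0 < eps -> exists delta, 0 < delta /\
       forall t x' y', 0 < t < delta -> Rabs (x' - x) < delta ->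
         Rabs (y' - y) < delta -> Rabs (T t x' y' - T0 x y) < eps).

Definition conv_to_one_loc_unif (T : R -> R -> R -> R) : Prop :=
  forall Rb eps, 0 < Rb -> 0 < eps -> exists t0, forall t x y,
    t0 < t -> Rabs x <= Rb -> Rabs y <= Rb -> Rabs (T t x y - 1) < eps.

(* Main.v *)
(** All comparisons are with explicit barriers.  After rescaling to [l = 1], functions
    of [h = sin x sin y] do not feel the flow, and [|grad h|^2 >= 2 h (1 - h)] makes
    [phi(h) = th1 ((1 + eta - h)^(-q) - 1)] a stationary subsolution inside the cell
    when [M l^2] is large; so the centre of the cell stays above some [th' > theta_0]
    forever.  The mirror [x -> 2 k PI - x] commutes with the linear operator, whence
    the eventual lower bounds [a_k] of [T] on the lines [x = k PI] satisfy
    [2 a_k >= a_(k-1) + a_(k+1)]; a bounded concave sequence on [Z] is constant, say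
    [a_k = a].  A moving bump carries the value [th'] from the cell to the line [x = 0],
    which gives [a >= th' > theta_0], and then the reaction term rules out [a < 1]. *)

Require Import Defs.
From Stdlib Require Import Reals Lra Lia Psatz Classical ClassicalEpsilon ZArith.
From Coquelicot Require Import Coquelicot.
Open Scope R_scope.

(** * Compactness and first touching times *)

(** The threshold on [M l^2] must not depend on [A], although the rescaled amplitude [A l] is
    arbitrary. The size of the reaction therefore has to be exploited where the flow drops out, on
    functions of [h], which are constant along streamlines. After the cell is ignited every estimate
    is qualitative: rates and waiting times may depend on [A], because only limits in time are
    compared. Between the ignition of the cell and the final step the reaction enters only through
    [f >= 0]: the solution is then a supersolution of a linear equation, and linearity permits
    averaging it with its mirror image. The asymptotic level is defined as a supremum of eventual
    lower bounds, so that any strict improvement of such a bound on one wall is already a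
    contradiction. All barriers satisfy strict inequalities, so that the derivative tests at a first
    touching point exclude contact. *)

Lemma interval_uniform (P : R -> R -> Prop) (a b : R) :
  (forall d d' x, 0 < d' <= d -> P d x -> P d' x) ->
  (forall x, a <= x <= b ->
     exists d, 0 < d /\ forall x', Rabs (x' - x) < d -> P d x') ->
  exists d, 0 < d /\ forall x, a <= x <= b -> P d x.
Proof.
  intros Pmono Ploc.
  assert (Hd : forall x, exists d : posreal,
            a <= x <= b -> forall x', Rabs (x' - x) < d -> P d x').
  { intros x. destruct (classic (a <= x <= b)) as [Hx | Hx].
    - destruct (Ploc x Hx) as (d & d0 & H). now exists (mkposreal d d0).
    - exists (mkposreal 1 Rlt_0_1). tauto. }
  set (delta := fun x => proj1_sig (constructive_indefinite_description _ (Hd x))).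
  assert (Hdelta : forall x, a <= x <= b ->
            forall x', Rabs (x' - x) < delta x -> P (delta x) x').
  { intros x. exact (proj2_sig (constructive_indefinite_description _ (Hd x))). }
  (* Compactness in gauge form: up to a double negation, every [x] lies within [delta t] of some tag
     [t] with [d <= delta t]. *)
  destruct (compactness_value_1d a b delta) as [d H].
  exists d. split; [apply cond_pos |]. intros x Hx.
  destruct (NNPP _ (H x Hx)) as (t & Ht & Hxt & Hdt).
  apply (Pmono (delta t)); [split; [apply cond_pos | exact Hdt] |].
  now apply Hdelta.
Qed.

Lemma tube (Q : R -> R -> R -> Prop) (x1 x2 y1 y2 : R) :
  (forall x y, x1 <= x <= x2 -> y1 <= y <= y2 -> exists d, 0 < d /\
     forall s x' y', Rabs s < d -> Rabs (x' - x) < d -> Rabs (y' - y) < d ->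
       Q s x' y') ->
  exists d, 0 < d /\ forall s x y, Rabs s < d -> x1 <= x <= x2 ->
    y1 <= y <= y2 -> Q s x y.
Proof.
  intros HQ.
  destruct (interval_uniform
    (fun d x => forall s y, Rabs s < d -> y1 <= y <= y2 -> Q s x y) x1 x2)
    as (d & d0 & H).
  - intros d d' x Hd H s y Hs. apply H. lra.
  - intros x Hx.
    destruct (interval_uniform
      (fun d y => forall s x', Rabs s < d -> Rabs (x' - x) < d -> Q s x' y) y1 y2)
      as (d & d0 & H).
    + intros d d' y Hd H s x' Hs Hx'. apply H; lra.
    + intros y Hy. destruct (HQ x y Hx Hy) as (d & d0 & H).
      exists d. split; auto.
    + exists d. split; auto.
  - exists d. split; auto.
Qed.

(** The touching time is the supremum of the times up to which [G] is positive on the rectangle. By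
    [tube], positivity on the whole rectangle at that time would persist a little longer, so [G]
    vanishes somewhere, while continuity keeps it nonnegative up to and including that time. *)
Lemma first_touch (G : R -> R -> R -> R) (t0 x1 x2 y1 y2 : R) :
  (forall x y, x1 <= x <= x2 -> y1 <= y <= y2 -> 0 < G t0 x y) ->
  (forall t x y, t0 <= t -> cont3 G t x y) ->
  (forall t x y, t0 < t -> x1 <= x <= x2 -> y1 <= y <= y2 -> G t x y = 0 ->
     (forall s x' y', t0 <= s <= t -> x1 <= x' <= x2 -> y1 <= y' <= y2 ->
        0 <= G s x' y') -> False) ->
  forall t x y, t0 <= t -> x1 <= x <= x2 -> y1 <= y <= y2 -> 0 < G t x y.
Proof.
  intros Hinit Hcont Htouch t1 xx yy Ht1 Hxx Hyy.
  destruct (Rlt_or_le 0 (G t1 xx yy)) as [?|Hneg]; [assumption | exfalso].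
  set (E := fun s => t0 <= s <= t1 /\ forall s' x y, t0 <= s' <= s ->
              x1 <= x <= x2 -> y1 <= y <= y2 -> 0 < G s' x y).
  assert (E0 : E t0).
  { split; [lra |]. intros s' x y Hs. replace s' with t0 by lra. apply Hinit. }
  destruct (completeness E) as [t [Hub Hlub]].
  { exists t1. intros s [Hs _]. lra. }
  { now exists t0. }
  pose proof (Hub t0 E0) as Ht0.
  assert (Htt1 : t <= t1) by (apply Hlub; intros s [Hs _]; lra).
  assert (Hbefore : forall s x y, t0 <= s < t -> x1 <= x <= x2 ->
            y1 <= y <= y2 -> 0 < G s x y).
  { intros s x y Hs Hx Hy.
    assert (He : exists e, E e /\ s < e).
    { apply NNPP. intros Hn. assert (t <= s); [| lra].
      apply Hlub. intros e He. apply Rnot_lt_le. intros Hse. apply Hn. eauto. }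
    destruct He as (e & [_ He] & Hse). apply He; auto; lra. }
  assert (Hexists : exists x y, x1 <= x <= x2 /\ y1 <= y <= y2 /\ G t x y <= 0).
  { apply NNPP. intros Hn.
    assert (Hpos : forall x y, x1 <= x <= x2 -> y1 <= y <= y2 -> 0 < G t x y).
    { intros x y Hx Hy. apply Rnot_le_lt. intros Hle. apply Hn. eauto. }
    destruct (tube (fun s x y => 0 < G (t + s) x y) x1 x2 y1 y2) as (d & d0 & Hd).
    { intros x y Hx Hy.
      destruct (Hcont t x y Ht0 (G t x y) (Hpos x y Hx Hy)) as (d & d0 & Hd).
      exists d. split; [assumption |]. intros s x' y' Hs Hx' Hy'.
      assert (H : Rabs (G (t + s) x' y' - G t x y) < G t x y).
      { apply Hd; auto. now replace (t + s - t) with s by ring. }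
      apply Rabs_def2 in H. lra. }
    (* The cap at [t1] is forced by the definition of [E]. If it is active, [G] is positive at [t1],
       against [Hneg]; otherwise [t] is not an upper bound. *)
    assert (HE : E (Rmin t1 (t + d / 2))).
    { split.
      - split; [apply Rmin_glb; lra | apply Rmin_l].
      - intros s x y Hs Hx Hy.
        destruct (Rlt_or_le s t) as [Hst | Hst]; [apply Hbefore; auto; lra |].
        replace s with (t + (s - t)) by ring. apply Hd; auto.
        pose proof (Rmin_r t1 (t + d / 2)). apply Rabs_def1; lra. }
    pose proof (Hub _ HE) as Hle. destruct HE as [_ HE].
    destruct (Rle_or_lt t1 (t + d / 2)) as [H | H].
    - rewrite Rmin_left in HE by lra. specialize (HE t1 xx yy). lra.
    - rewrite Rmin_right in Hle by lra. lra. }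
  destruct Hexists as (x & y & Hx & Hy & HG).
  assert (Hlt : t0 < t).
  { destruct (Rle_lt_or_eq_dec t0 t Ht0) as [H | H]; [assumption |].
    rewrite <- H in HG. specialize (Hinit x y Hx Hy). lra. }
  assert (Hnonneg : forall s x' y', t0 <= s <= t -> x1 <= x' <= x2 ->
            y1 <= y' <= y2 -> 0 <= G s x' y').
  { intros s x' y' Hs Hx' Hy'.
    destruct (Rlt_or_le s t) as [Hst | Hst]; [left; apply Hbefore; auto; lra |].
    replace s with t by lra. apply Rnot_lt_le. intros HG'.
    destruct (Hcont t x' y' Ht0 (- G t x' y')) as (d & d0 & Hd); [lra |].
    assert (Hs' : t0 <= Rmax t0 (t - d / 2) < t).
    { split; [apply Rmax_l | apply Rmax_lub_lt; lra]. }
    pose proof (Hbefore _ x' y' Hs' Hx' Hy') as Hb.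
    assert (H : Rabs (G (Rmax t0 (t - d / 2)) x' y' - G t x' y') < - G t x' y').
    { pose proof (Rmax_r t0 (t - d / 2)).
      apply Hd; rewrite ?Rminus_diag, ?Rabs_R0; auto. apply Rabs_def1; lra. }
    apply Rabs_def2 in H. lra. }
  apply (Htouch t x y); auto. specialize (Hnonneg t x y). lra.
Qed.

Lemma derive_left_touch (g : R -> R) (t0 t d : R) :
  t0 < t -> is_derive g t d -> g t = 0 ->
  (forall s, t0 <= s <= t -> 0 <= g s) -> d <= 0.
Proof.
  intros Ht Hd Hg Hpos. apply Rnot_lt_le. intros Hd0.
  apply is_derive_Reals in Hd. destruct (Hd (d / 2)) as [r Hr]; [lra |].
  pose proof (cond_pos r) as r0.
  set (e := Rmin (r / 2) (t - t0)).
  assert (He : 0 < e <= t - t0 /\ e <= r / 2).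
  { unfold e. repeat split; [apply Rmin_glb_lt; lra | apply Rmin_r | apply Rmin_l]. }
  specialize (Hr (- e)).
  assert (H : Rabs ((g (t + - e) - g t) / - e - d) < d / 2).
  { apply Hr; [lra |]. rewrite Rabs_Ropp, Rabs_pos_eq; lra. }
  apply Rabs_def2 in H. rewrite Hg in H.
  assert (Hge : 0 <= g (t + - e)) by (apply Hpos; lra).
  assert ((g (t + - e) - 0) / - e <= 0); [| lra].
  replace ((g (t + - e) - 0) / - e) with (- (g (t + - e) / e)) by (field; lra).
  assert (0 <= g (t + - e) / e); [| lra].
  apply Rdiv_le_0_compat; lra.
Qed.

(** A one-sided test applied to [g] and to its reflection gives both signs of [g' z]. A negative
    [g2] would make [g'] negative just to the right of [z], and the mean value theorem would push
    [g] below [g z]. *)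
Lemma local_min_derive (g g' : R -> R) (z g2 : R) :
  (forall x, is_derive g x (g' x)) -> is_derive g' z g2 ->
  (exists r, 0 < r /\ forall x, Rabs (x - z) < r -> g z <= g x) ->
  g' z = 0 /\ 0 <= g2.
Proof.
  intros Hg Hg' (r & r0 & Hmin).
  assert (H0 : g' z = 0).
  { apply Rle_antisym.
    - apply (derive_left_touch (fun x => g x - g z) (z - r / 2) z); [lra | | lra |].
      + replace (g' z) with (minus (g' z) 0) by (unfold minus, plus, opp; simpl; ring).
        apply (is_derive_minus g (fun _ => g z)); [apply Hg | apply is_derive_Reals, derivable_pt_lim_const].
      + intros s Hs. specialize (Hmin s). rewrite Rabs_left1 in Hmin by lra. lra.
    - apply Ropp_le_cancel. rewrite Ropp_0.
      apply (derive_left_touch (fun x => g (- x) - g z) (- z - r / 2) (- z)); [lra | | rewrite Ropp_involutive; lra |].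
      + pose proof (Hg z) as Hz. rewrite <- (Ropp_involutive z) in Hz at 1.
        evar_last.
        * apply (is_derive_minus (fun x => g (- x)) (fun _ => g z)).
          -- apply (is_derive_comp g Ropp); [exact Hz | apply is_derive_Reals, derivable_pt_lim_opp, derivable_pt_lim_id].
          -- apply is_derive_Reals, derivable_pt_lim_const.
        * unfold minus, plus, opp, scal; simpl. unfold mult; simpl. ring.
      + intros s Hs. specialize (Hmin (- s)). rewrite Rabs_right in Hmin by lra. lra. }
  split; [exact H0 |].
  apply Rnot_lt_le. intros Hneg.
  apply is_derive_Reals in Hg'. destruct (Hg' (- g2 / 2)) as [d Hd]; [lra |].
  pose proof (cond_pos d) as d0.
  set (e := Rmin (d / 2) (r / 2)).
  assert (He : 0 < e /\ e <= d / 2 /\ e <= r / 2).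
  { unfold e. repeat split; [apply Rmin_glb_lt; lra | apply Rmin_l | apply Rmin_r]. }
  destruct (MVT_cor2 g g' z (z + e)) as (c & Heq & Hc); [lra | |].
  { intros x _. apply is_derive_Reals, Hg. }
  specialize (Hmin (z + e)). rewrite Rabs_right in Hmin by lra.
  specialize (Hd (c - z)). replace (z + (c - z)) with c in Hd by ring.
  rewrite H0 in Hd.
  assert (H : Rabs ((g' c - 0) / (c - z) - g2) < - g2 / 2).
  { apply Hd; [lra |]. rewrite Rabs_right; lra. }
  apply Rabs_def2 in H.
  assert (Hneg' : g' c < 0).
  { replace (g' c) with ((g' c - 0) / (c - z) * (c - z)) by (field; lra).
    assert ((g' c - 0) / (c - z) < 0) by lra. nra. }
  assert (g' c * (z + e - z) < 0) by nra. lra.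
Qed.

(** * Comparison principles *)

Lemma cont3_plus (g k : R -> R -> R -> R) (t x y : R) :
  cont3 g t x y -> cont3 k t x y ->
  cont3 (fun t x y => g t x y + k t x y) t x y.
Proof.
  intros Hg Hk eps Heps.
  destruct (Hg (eps / 2)) as (d & d0 & Hd); [lra |].
  destruct (Hk (eps / 2)) as (e & e0 & He); [lra |].
  exists (Rmin d e). split; [now apply Rmin_glb_lt |].
  intros t' x' y' Ht Hx Hy.
  pose proof (Rmin_l d e). pose proof (Rmin_r d e).
  specialize (Hd t' x' y'). specialize (He t' x' y').
  replace (g t' x' y' + k t' x' y' - (g t x y + k t x y))
    with ((g t' x' y' - g t x y) + (k t' x' y' - k t x y)) by ring.
  eapply Rle_lt_trans; [apply Rabs_triang |]. lra.
Qed.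

Lemma cont3_comp (g : R -> R) (k : R -> R -> R -> R) (t x y : R) :
  continuous g (k t x y) -> cont3 k t x y ->
  cont3 (fun t x y => g (k t x y)) t x y.
Proof.
  intros Hg Hk eps Heps.
  destruct (Hg (ball (g (k t x y)) eps)) as (d & Hd).
  { now exists (mkposreal eps Heps). }
  destruct (Hk d (cond_pos d)) as (e & e0 & He).
  exists e. split; [assumption |]. intros t' x' y' Ht Hx Hy.
  apply Hd, He; assumption.
Qed.

Lemma cont3_scal (c : R) (g : R -> R -> R -> R) (t x y : R) :
  cont3 g t x y -> cont3 (fun t x y => c * g t x y) t x y.
Proof.
  intros Hg. apply (cont3_comp (fun z => c * z)); [| assumption].
  apply (ex_derive_continuous (fun z => c * z)). auto_derive. exact I.
Qed.

Lemma cont3_minus (g k : R -> R -> R -> R) (t x y : R) :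
  cont3 g t x y -> cont3 k t x y ->
  cont3 (fun t x y => g t x y - k t x y) t x y.
Proof.
  intros Hg Hk. apply cont3_plus; [assumption |].
  apply (cont3_comp Ropp); [| assumption].
  apply (ex_derive_continuous Ropp). auto_derive. exact I.
Qed.

(* Polarization: a product is a combination of squares. *)
Lemma cont3_mult (g k : R -> R -> R -> R) (t x y : R) :
  cont3 g t x y -> cont3 k t x y ->
  cont3 (fun t x y => g t x y * k t x y) t x y.
Proof.
  intros Hg Hk.
  assert (Hsq : forall w, cont3 w t x y ->
            cont3 (fun t x y => (1 / 4) * (w t x y * w t x y)) t x y).
  { intros w Hw. apply (cont3_comp (fun z => (1 / 4) * (z * z))); [| assumption].
    apply (ex_derive_continuous (fun z => (1 / 4) * (z * z))). auto_derive. exact I. }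
  pose proof (cont3_minus _ _ t x y (Hsq _ (cont3_plus _ _ _ _ _ Hg Hk))
                (Hsq _ (cont3_minus _ _ _ _ _ Hg Hk))) as H.
  intros eps Heps. destruct (H eps Heps) as (d & d0 & Hd).
  exists d. split; [assumption |]. intros t' x' y' Ht Hx Hy.
  eapply Rle_lt_trans; [right | exact (Hd t' x' y' Ht Hx Hy)].
  f_equal. field.
Qed.

Lemma cont3_const (c t x y : R) : cont3 (fun _ _ _ => c) t x y.
Proof.
  intros eps Heps. exists 1. split; [lra |]. intros.
  now rewrite Rminus_diag, Rabs_R0.
Qed.

Lemma cont3_t (t x y : R) : cont3 (fun t _ _ => t) t x y.
Proof. intros eps Heps. now exists eps. Qed.

Lemma cont3_x (t x y : R) : cont3 (fun _ x _ => x) t x y.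
Proof. intros eps Heps. now exists eps. Qed.

Lemma cont3_y (t x y : R) : cont3 (fun _ _ y => y) t x y.
Proof. intros eps Heps. now exists eps. Qed.

(** Derivatives are carried as data, so that [heat] of an explicit barrier reduces by computation;
    [regular] asserts that the fields really are the derivatives. *)
Record jet := Jet {
  jv : R -> R -> R -> R;
  jt : R -> R -> R -> R;
  jx : R -> R -> R -> R;
  jy : R -> R -> R -> R;
  jxx : R -> R -> R -> R;
  jyy : R -> R -> R -> R }.

Definition regular (V : jet) : Prop :=
  forall t x y, 0 < t ->
    is_derive (fun s => jv V s x y) t (jt V t x y) /\
    is_derive (fun z => jv V t z y) x (jx V t x y) /\
    is_derive (fun z => jv V t x z) y (jy V t x y) /\
    is_derive (fun z => jx V t z y) x (jxx V t x y) /\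
    is_derive (fun z => jy V t x z) y (jyy V t x y) /\
    cont3 (jv V) t x y.

(* The linear operator d_t + A u . grad - Delta for cells of size l = 1. *)
Definition heat (A : R) (V : jet) (t x y : R) : R :=
  jt V t x y + A * (sin x * cos y * jx V t x y - cos x * sin y * jy V t x y)
  - jxx V t x y - jyy V t x y.

(** At a first contact the gradients agree, so the drift terms cancel for every [A]; the time
    derivative and the second derivatives of [V - W] have the favourable signs. *)
Lemma heat_at_touch (A : R) (V W : jet) (t0 t x y : R) :
  regular V -> regular W -> 0 < t0 < t ->
  jv V t x y = jv W t x y ->
  (forall s, t0 <= s <= t -> jv W s x y <= jv V s x y) ->
  (exists r, 0 < r /\ forall z, Rabs (z - x) < r -> jv W t z y <= jv V t z y) ->
  (exists r, 0 < r /\ forall z, Rabs (z - y) < r -> jv W t x z <= jv V t x z) ->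
  heat A V t x y <= heat A W t x y.
Proof.
  intros HV HW Ht Heq Hbefore (rx & rx0 & Hx) (ry & ry0 & Hy).
  assert (Ht0 : 0 < t) by lra.
  destruct (HV t x y Ht0) as (Vt & _ & _ & Vxx & Vyy & _).
  destruct (HW t x y Ht0) as (Wt & _ & _ & Wxx & Wyy & _).
  assert (H1 : jt V t x y - jt W t x y <= 0).
  { apply (derive_left_touch (fun s => jv V s x y - jv W s x y) t0 t); try lra.
    - apply (is_derive_minus (fun s => jv V s x y) (fun s => jv W s x y)); assumption.
    - intros s Hs. specialize (Hbefore s Hs). lra. }
  assert (H2 : jx V t x y - jx W t x y = 0 /\ 0 <= jxx V t x y - jxx W t x y).
  { apply (local_min_derive (fun z => jv V t z y - jv W t z y)
             (fun z => jx V t z y - jx W t z y)).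
    - intros z. apply (is_derive_minus (fun z => jv V t z y) (fun z => jv W t z y));
        [apply HV | apply HW]; assumption.
    - apply (is_derive_minus (fun z => jx V t z y) (fun z => jx W t z y)); assumption.
    - exists rx. split; [assumption |]. intros z Hz. specialize (Hx z Hz). lra. }
  assert (H3 : jy V t x y - jy W t x y = 0 /\ 0 <= jyy V t x y - jyy W t x y).
  { apply (local_min_derive (fun z => jv V t x z - jv W t x z)
             (fun z => jy V t x z - jy W t x z)).
    - intros z. apply (is_derive_minus (fun z => jv V t x z) (fun z => jv W t x z));
        [apply HV | apply HW]; assumption.
    - apply (is_derive_minus (fun z => jy V t x z) (fun z => jy W t x z)); assumption.
    - exists ry. split; [assumption |]. intros z Hz. specialize (Hy z Hz). lra. }
  unfold heat. replace (jx V t x y) with (jx W t x y) by lra.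
  replace (jy V t x y) with (jy W t x y) by lra. lra.
Qed.

Lemma interior_ball (a b x : R) : a < x < b ->
  exists r, 0 < r /\ forall z, Rabs (z - x) < r -> a <= z <= b.
Proof.
  intros Hx. exists (Rmin (x - a) (b - x)). split; [apply Rmin_glb_lt; lra |].
  intros z Hz. apply Rabs_def2 in Hz.
  pose proof (Rmin_l (x - a) (b - x)). pose proof (Rmin_r (x - a) (b - x)). lra.
Qed.

(** The inequality for [heat] is asked for only at points where [V] and [W] coincide. A user may
    thus replace [f (V)] by [f] of the barrier, or discard the places where contact is
    impossible. *)
Lemma comparison_box (A : R) (V W : jet) (t0 x1 x2 y1 y2 : R) :
  0 < t0 -> regular V -> regular W ->
  (forall x y, x1 <= x <= x2 -> y1 <= y <= y2 -> jv W t0 x y < jv V t0 x y) ->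
  (forall t x y, t0 <= t -> x1 <= x <= x2 -> y1 <= y <= y2 ->
     x = x1 \/ x = x2 \/ y = y1 \/ y = y2 -> jv W t x y < jv V t x y) ->
  (forall t x y, t0 < t -> x1 < x < x2 -> y1 < y < y2 ->
     jv V t x y = jv W t x y -> heat A W t x y < heat A V t x y) ->
  forall t x y, t0 <= t -> x1 <= x <= x2 -> y1 <= y <= y2 ->
    jv W t x y < jv V t x y.
Proof.
  intros Ht0 HV HW Hinit Hbdry Hheat t x y Ht Hx Hy.
  apply Rlt_0_minus.
  apply (first_touch (fun t x y => jv V t x y - jv W t x y) t0 x1 x2 y1 y2); auto.
  - intros x' y' Hx' Hy'. apply Rlt_0_minus; auto.
  - intros s x' y' Hs.
    apply cont3_minus; [apply HV | apply HW]; lra.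
  - clear t x y Ht Hx Hy. intros t x y Ht Hx Hy Heq Hpos.
    assert (Hnb : ~ (x = x1 \/ x = x2 \/ y = y1 \/ y = y2)).
    { intros Hb. specialize (Hbdry t x y). specialize (Hbdry ltac:(lra) Hx Hy Hb). lra. }
    assert (Hx' : x1 < x < x2) by (destruct Hx as [[|] [|]]; tauto || lra).
    assert (Hy' : y1 < y < y2) by (destruct Hy as [[|] [|]]; tauto || lra).
    apply (Rlt_not_le (heat A V t x y) (heat A W t x y)); [apply Hheat; auto; lra |].
    apply (heat_at_touch A V W t0); auto; try lra.
    + intros s Hs. specialize (Hpos s x y Hs Hx Hy). lra.
    + destruct (interior_ball _ _ _ Hx') as (r & r0 & Hr).
      exists r. split; [assumption |]. intros z Hz.
      specialize (Hpos t z y ltac:(lra) (Hr z Hz) Hy). lra.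
    + destruct (interior_ball _ _ _ Hy') as (r & r0 & Hr).
      exists r. split; [assumption |]. intros z Hz.
      specialize (Hpos t x z ltac:(lra) Hx (Hr z Hz)). lra.
Qed.

Definition y_periodic (g : R -> R -> R -> R) : Prop :=
  forall t x y, 0 < t -> g t x (y + 2 * PI) = g t x y.

Lemma y_periodic_fundamental (g : R -> R -> R -> R) (t y : R) :
  y_periodic g -> 0 < t ->
  exists y', 0 <= y' <= 2 * PI /\ forall x, g t x y = g t x y'.
Proof.
  intros Hg Ht.
  assert (Hn : forall n x y, g t x (y + INR n * (2 * PI)) = g t x y).
  { induction n as [|n IH]; intros x z.
    - f_equal. simpl. ring.
    - rewrite S_INR, <- (IH x z), <- (Hg t x (z + INR n * (2 * PI)) Ht).
      f_equal. ring. }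
  assert (Hz : forall k x y, g t x (y + IZR k * (2 * PI)) = g t x y).
  { intros k x z. destruct (Z_le_gt_dec 0 k) as [Hk | Hk].
    - rewrite <- (Z2Nat.id k Hk), <- INR_IZR_INZ. apply Hn.
    - rewrite <- (Hn (Z.to_nat (- k)) x (z + IZR k * (2 * PI))), INR_IZR_INZ,
        Z2Nat.id by lia.
      f_equal. rewrite opp_IZR. ring. }
  pose proof PI_RGT_0 as Hpi.
  destruct (archimed (y / (2 * PI))) as [H1 H2].
  set (k := up (y / (2 * PI))) in *.
  assert (Hy : y = y / (2 * PI) * (2 * PI)) by (field; lra).
  (* [up] exceeds its argument by at most 1, hence the shift by [1 - k] rather than [- k]. *)
  exists (y + IZR (1 - k) * (2 * PI)). split.
  - rewrite minus_IZR. split; nra.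
  - intros x. symmetry. apply Hz.
Qed.

(** Compactness is obtained on one period. Contact at [y = 0] or [y = 2 PI] is still interior, since
    the sign of [V - W] extends to all [y] by periodicity. *)
Lemma comparison_strip (A : R) (V W : jet) (t0 x1 x2 : R) :
  0 < t0 -> regular V -> regular W -> y_periodic (jv V) -> y_periodic (jv W) ->
  (forall x y, x1 <= x <= x2 -> jv W t0 x y < jv V t0 x y) ->
  (forall t y, t0 <= t -> jv W t x1 y < jv V t x1 y) ->
  (forall t y, t0 <= t -> jv W t x2 y < jv V t x2 y) ->
  (forall t x y, t0 < t -> x1 < x < x2 ->
     jv V t x y = jv W t x y -> heat A W t x y < heat A V t x y) ->
  forall t x y, t0 <= t -> x1 <= x <= x2 -> jv W t x y < jv V t x y.
Proof.
  intros Ht0 HV HW PV PW Hinit Hx1 Hx2 Hheat.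
  assert (PG : y_periodic (fun t x y => jv V t x y - jv W t x y)).
  { intros t x y Ht. now rewrite PV, PW. }
  intros t x y Ht Hx. apply Rlt_0_minus.
  destruct (y_periodic_fundamental _ t y PG) as (y' & Hy' & Heq); [lra |].
  rewrite (Heq x). clear Heq. revert t x y' Ht Hx Hy'.
  apply (first_touch (fun t x y => jv V t x y - jv W t x y) t0 x1 x2 0 (2 * PI)).
  - intros x' y' Hx' Hy'. apply Rlt_0_minus; auto.
  - intros s x' y' Hs.
    apply cont3_minus; [apply HV | apply HW]; lra.
  - clear y. intros t x y Ht Hx Hy Heq Hpos.
    assert (Hpos' : forall s x' y', t0 <= s <= t -> x1 <= x' <= x2 ->
              jv W s x' y' <= jv V s x' y').
    { intros s x' y' Hs Hx'.
      destruct (y_periodic_fundamental _ s y' PG) as (y'' & Hy'' & E); [lra |].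
      specialize (Hpos s x' y'' Hs Hx' Hy''). specialize (E x'). simpl in E. lra. }
    assert (Hx' : x1 < x < x2).
    { specialize (Hx1 t y ltac:(lra)). specialize (Hx2 t y ltac:(lra)).
      destruct Hx as [[ | <- ] [ | -> ]]; lra. }
    apply (Rlt_not_le (heat A V t x y) (heat A W t x y)); [apply Hheat; auto; lra |].
    apply (heat_at_touch A V W t0); auto; try lra.
    + destruct (interior_ball _ _ _ Hx') as (r & r0 & Hr).
      exists r. split; [assumption |]. intros z Hz. apply Hpos'; auto; lra.
    + exists 1. split; [lra |]. intros z Hz. apply Hpos'; lra.
Qed.

(** * Supersolutions of the linear equation *)

Definition supersolution (A : R) (V : jet) : Prop :=
  regular V /\ y_periodic (jv V) /\
  forall t x y, 0 < t -> 0 <= jv V t x y /\ 0 <= heat A V t x y.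

Ltac cont3_step :=
  match goal with
  | |- cont3 (fun _ _ _ => ?c) _ _ _ => apply cont3_const
  | |- cont3 (fun t _ _ => t) _ _ _ => apply cont3_t
  | |- cont3 (fun _ x _ => x) _ _ _ => apply cont3_x
  | |- cont3 (fun _ _ y => y) _ _ _ => apply cont3_y
  | |- cont3 (fun t x y => @?g t x y + @?k t x y) _ _ _ => apply (cont3_plus g k)
  | |- cont3 (fun t x y => @?g t x y - @?k t x y) _ _ _ => apply (cont3_minus g k)
  | |- cont3 (fun t x y => @?g t x y * @?k t x y) _ _ _ => apply (cont3_mult g k)
  | |- cont3 (fun t x y => ?g (@?k t x y)) _ _ _ =>
      apply (cont3_comp g k);
      [apply (ex_derive_continuous g); auto_derive; exact I |]
  end.

Ltac prove_regular :=
  refine (conj _ (conj _ (conj _ (conj _ (conj _ _)))));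
  [auto_derive; [repeat split | unfold Rminus; ring] .. | repeat cont3_step].

Lemma trig_prod_bound (a b : R) : Rabs (sin a * cos b) <= 1.
Proof.
  rewrite Rabs_mult.
  pose proof (SIN_bound a). pose proof (COS_bound b).
  assert (Rabs (sin a) <= 1) by (apply Rabs_le; lra).
  assert (Rabs (cos b) <= 1) by (apply Rabs_le; lra).
  pose proof (Rabs_pos (sin a)). pose proof (Rabs_pos (cos b)). nra.
Qed.

Lemma Rmult_abs_le (a b c : R) : Rabs b <= c -> a * b <= Rabs a * c.
Proof.
  intros H. eapply Rle_trans; [apply Rle_abs |]. rewrite Rabs_mult.
  apply Rmult_le_compat_l; [apply Rabs_pos | assumption].
Qed.

(** * Relaxation in a vertical strip *)

Definition strip_barrier (c C lam E2 b t0 x1 : R) : jet := Jet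
  (fun t x _ => c - C * exp (- lam * (t - t0)) * (E2 + 1 - exp (b * (x - x1))))
  (fun t x _ => C * lam * exp (- lam * (t - t0)) * (E2 + 1 - exp (b * (x - x1))))
  (fun t x _ => C * exp (- lam * (t - t0)) * (b * exp (b * (x - x1))))
  (fun _ _ _ => 0)
  (fun t x _ => C * exp (- lam * (t - t0)) * (b * b * exp (b * (x - x1))))
  (fun _ _ _ => 0).

Lemma strip_barrier_regular (c C lam E2 b t0 x1 : R) :
  regular (strip_barrier c C lam E2 b t0 x1).
Proof.
  intros t x y Ht. simpl. unfold strip_barrier; simpl.
  prove_regular.
Qed.

(** The correction [E2 + 1 - exp (b (x - x1))] stays between 1 and [E2] on the strip. As
    [b = |A| + 1] exceeds the drift speed by 1, the stationary operator maps it to at least [b];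
    decay in time at rate [lam = b / (2 E2)] uses up at most half of this. *)
Lemma strip_relaxation (A : R) (V : jet) (t0 x1 x2 c eps : R) :
  supersolution A V -> 0 < t0 -> 0 < eps ->
  (forall t y, t0 <= t -> c < jv V t x1 y) ->
  (forall t y, t0 <= t -> c < jv V t x2 y) ->
  exists t1, t0 <= t1 /\ forall t x y, t1 <= t -> x1 <= x <= x2 ->
    c - eps < jv V t x y.
Proof.
  intros (HV & PV & Hsup) Ht0 Heps H1 H2.
  set (b := Rabs A + 1). set (E2 := exp (b * (x2 - x1))).
  (* With this [C] the barrier is at most [c - C <= -1] at time [t0], hence below the nonnegative
     [V]. *)
  set (C := Rabs c + 1). set (lam := b / (2 * E2)).
  pose proof (Rabs_pos A) as HA. pose proof (Rle_abs c) as Hc.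
  pose proof (Rabs_pos c) as Hc'.
  assert (HE2 : 0 < E2) by apply exp_pos.
  assert (HlamE : lam * E2 = b / 2) by (unfold lam; field; lra).
  assert (Hb : 1 <= b) by (unfold b; lra).
  assert (HC : 0 < C) by (unfold C; lra).
  assert (Hlam : 0 < lam) by (unfold lam; apply Rdiv_lt_0_compat; lra).
  assert (HE : forall x, x1 <= x <= x2 -> 1 <= exp (b * (x - x1)) <= E2).
  { intros x Hx. split.
    - rewrite <- exp_0.
      destruct (Req_dec x x1) as [-> |]; [rewrite Rminus_diag, Rmult_0_r; right; reflexivity |].
      left. apply exp_increasing. nra.
    - unfold E2. destruct (Req_dec x x2) as [-> |]; [lra |].
      left. apply exp_increasing. nra. }
  assert (Hcomp : forall t x y, t0 <= t -> x1 <= x <= x2 ->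
            jv (strip_barrier c C lam E2 b t0 x1) t x y < jv V t x y).
  { intros t x y Ht Hx.
    assert (Hx12 : x1 <= x2) by lra.
    revert t x y Ht Hx.
    apply (comparison_strip A); auto using strip_barrier_regular.
    - intros t x y Ht. reflexivity.
    - intros x y Hx. destruct (Hsup t0 x y Ht0) as [Hp _].
      specialize (HE x Hx). simpl. rewrite Rminus_diag, Rmult_0_r, exp_0.
      unfold C in *. nra.
    - intros t y Ht. specialize (H1 t y Ht). specialize (HE x1 ltac:(lra)).
      pose proof (exp_pos (- lam * (t - t0))). simpl.
      assert (0 < C * exp (- lam * (t - t0))) by nra. nra.
    - intros t y Ht. specialize (H2 t y Ht). specialize (HE x2 ltac:(lra)).
      pose proof (exp_pos (- lam * (t - t0))). simpl.
      assert (0 < C * exp (- lam * (t - t0))) by nra. nra.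
    - intros t x y Ht Hx _.
      destruct (Hsup t x y) as [_ Hp]; [lra |].
      apply Rlt_le_trans with 0; [| assumption].
      specialize (HE x ltac:(lra)). unfold heat; simpl.
      set (e := exp (- lam * (t - t0))). set (X := exp (b * (x - x1))) in *.
      assert (He : 0 < C * e) by (apply Rmult_lt_0_compat; [lra | apply exp_pos]).
      pose proof (Rmult_abs_le A _ _ (trig_prod_bound x y)) as Hd.
      set (s := A * (sin x * cos y)) in *.
      replace (_ - _ - 0) with
        (C * e * (lam * (E2 + 1 - X) + b * X * (s - b))) by (unfold s; ring).
      assert (lam * (E2 + 1 - X) <= b / 2) by nra.
      assert (s - b <= -1) by (unfold b; lra).
      assert (b * 1 <= b * X) by (apply Rmult_le_compat_l; lra).
      assert (b * X * (s - b) <= b * X * -1) by (apply Rmult_le_compat_l; lra).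
      nra. }
  (* By [1 + s <= exp s], after the time [tau] the correction [C e E2] is at most [eps]. *)
  set (tau := C * E2 / (lam * eps)).
  assert (Htau : 0 < tau) by (unfold tau; apply Rdiv_lt_0_compat; nra).
  exists (t0 + tau). split; [lra |]. intros t x y Ht Hx.
  specialize (Hcomp t x y ltac:(lra) Hx). simpl in Hcomp.
  specialize (HE x Hx).
  set (e := exp (- lam * (t - t0))) in *.
  assert (Hexp : 0 < e <= eps / (C * E2)).
  { split; [apply exp_pos |].
    unfold e. replace (- lam * (t - t0)) with (- (lam * (t - t0))) by ring.
    rewrite exp_Ropp.
    assert (Hbig : C * E2 / eps <= exp (lam * (t - t0))).
    { pose proof (exp_ineq1_le (lam * (t - t0))).
      assert (lam * tau <= lam * (t - t0)) by (apply Rmult_le_compat_l; lra).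
      assert (lam * tau = C * E2 / eps) by (unfold tau; field; lra). lra. }
    replace (eps / (C * E2)) with (/ (C * E2 / eps)) by (field; lra).
    apply Rinv_le_contravar; [apply Rdiv_lt_0_compat; nra | assumption]. }
  assert (C * e * (E2 + 1 - exp (b * (x - x1))) <= C * e * E2).
  { apply Rmult_le_compat_l; [nra | lra]. }
  assert (C * e * E2 <= eps).
  { replace eps with (C * E2 * (eps / (C * E2))) by (field; lra).
    replace (C * e * E2) with (C * E2 * e) by ring.
    apply Rmult_le_compat_l; [nra | lra]. }
  lra.
Qed.

(** * Reflection in the walls of the cells *)

Definition mirror_mean (V : jet) (a : R) : jet := Jet
  (fun t x y => / 2 * (jv V t x y + jv V t (2 * a - x) y))
  (fun t x y => / 2 * (jt V t x y + jt V t (2 * a - x) y))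
  (fun t x y => / 2 * (jx V t x y - jx V t (2 * a - x) y))
  (fun t x y => / 2 * (jy V t x y + jy V t (2 * a - x) y))
  (fun t x y => / 2 * (jxx V t x y + jxx V t (2 * a - x) y))
  (fun t x y => / 2 * (jyy V t x y + jyy V t (2 * a - x) y)).

Lemma is_derive_mean (g k : R -> R) (z dg dk : R) :
  is_derive g z dg -> is_derive k z dk ->
  is_derive (fun z => / 2 * (g z + k z)) z (/ 2 * (dg + dk)).
Proof.
  intros Hg Hk.
  apply (is_derive_scal (fun z => g z + k z)).
  now apply (is_derive_plus g k).
Qed.

Lemma is_derive_mirror (g : R -> R) (a z dg : R) :
  is_derive g (2 * a - z) dg -> is_derive (fun z => g (2 * a - z)) z (- dg).
Proof.
  intros Hg. evar_last.
  - apply (is_derive_comp g (fun z => 2 * a - z)); [exact Hg |].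
    auto_derive; [exact I | reflexivity].
  - unfold scal; simpl; unfold mult; simpl. ring.
Qed.

Lemma mirror_mean_regular (V : jet) (a : R) :
  regular V -> regular (mirror_mean V a).
Proof.
  intros HV t x y Ht. unfold mirror_mean; simpl.
  destruct (HV t x y Ht) as (H1 & H2 & H3 & H4 & H5 & H6).
  destruct (HV t (2 * a - x) y Ht) as (K1 & K2 & K3 & K4 & K5 & K6).
  split; [now apply is_derive_mean |].
  split; [apply is_derive_mean; [assumption |]; exact (is_derive_mirror (fun z => jv V t z y) a x _ K2) |].
  split; [now apply is_derive_mean |].
  split.
  { rewrite <- (Ropp_involutive (jxx V t (2 * a - x) y)).
    apply (is_derive_mean (fun z => jx V t z y) (fun z => - jx V t (2 * a - z) y));
      [assumption |].
    apply (is_derive_opp (fun z => jx V t (2 * a - z) y)).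
    exact (is_derive_mirror (fun z => jx V t z y) a x _ K4). }
  split; [now apply is_derive_mean |].
  apply (cont3_scal (/ 2) (fun t x y => jv V t x y + jv V t (2 * a - x) y)).
  apply (cont3_plus (jv V) (fun t x y => jv V t (2 * a - x) y)); [assumption |].
  intros eps Heps. destruct (K6 eps Heps) as (d & d0 & Hd).
  exists d. split; [assumption |]. intros t' x' y' Ht' Hx' Hy'.
  apply Hd; auto. rewrite <- Rabs_Ropp.
  now replace (- (2 * a - x' - (2 * a - x))) with (x' - x) by ring.
Qed.

(* The lines [x = k PI] are streamlines: the reflection across them reverses both [h] and
   the orientation, hence preserves the velocity field. *)
Lemma mirror_mean_supersolution (A : R) (V : jet) (a : R) :
  sin a = 0 -> supersolution A V -> supersolution A (mirror_mean V a).
Proof.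
  intros Ha (HV & PV & Hsup).
  split; [now apply mirror_mean_regular |]. split.
  { intros t x y Ht. simpl. now rewrite !PV. }
  intros t x y Ht.
  destruct (Hsup t x y Ht) as [H1 H2].
  destruct (Hsup t (2 * a - x) y Ht) as [H3 H4].
  split; [simpl; lra |].
  assert (Hs2 : sin (2 * a) = 0) by (rewrite sin_2a, Ha; ring).
  assert (Hc2 : cos (2 * a) = 1) by (rewrite cos_2a_sin, Ha; ring).
  assert (Hs : sin (2 * a - x) = - sin x) by (rewrite sin_minus, Hs2, Hc2; ring).
  assert (Hc : cos (2 * a - x) = cos x) by (rewrite cos_minus, Hs2, Hc2; ring).
  unfold heat in *. simpl. rewrite Hs, Hc in H4. lra.
Qed.

(* The centre [p + sin (t - t1) w] reaches [p + w] at time [t1 + PI / 2] and stays in a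
   bounded region for all times.  The cube of [z], unlike its square, is positive only
   inside the ball, so no truncation is needed. *)
Definition moving_bump (c D beta r px py wx wy t1 : R) : jet :=
  let e t := exp (- beta * (t - t1)) in
  let X t x := x - (px + sin (t - t1) * wx) in
  let Y t y := y - (py + sin (t - t1) * wy) in
  let z t x y := r * r - X t x * X t x - Y t y * Y t y in
  Jet
  (fun t x y => c + D * e t * (z t x y * z t x y * z t x y))
  (fun t x y => D * e t * (- beta * (z t x y * z t x y * z t x y)
     + 6 * (z t x y * z t x y) * cos (t - t1) * (X t x * wx + Y t y * wy)))
  (fun t x y => D * e t * (-6 * (z t x y * z t x y) * X t x))
  (fun t x y => D * e t * (-6 * (z t x y * z t x y) * Y t y))
  (fun t x y => D * e t * (24 * z t x y * (X t x * X t x) - 6 * (z t x y * z t x y)))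
  (fun t x y => D * e t * (24 * z t x y * (Y t y * Y t y) - 6 * (z t x y * z t x y))).

Lemma moving_bump_regular (c D beta r px py wx wy t1 : R) :
  regular (moving_bump c D beta r px py wx wy t1).
Proof.
  intros t x y Ht. unfold moving_bump; simpl.
  prove_regular.
Qed.

(** The gain factor [kappa] is fixed before [V], [c] and [delta]: it depends on [A], [r] and [W]
    alone. This order of quantifiers lets [c] be taken so close to the asymptotic level that the
    gain exceeds the gap. *)
Lemma moving_bump_positivity (A r W : R) : 0 < r -> 0 < W ->
  exists kappa, 0 < kappa /\
  forall (V : jet) (c delta px py qx qy t1 : R),
    supersolution A V -> 0 < t1 -> 0 < delta ->
    Rabs (qx - px) <= W -> Rabs (qy - py) <= W ->
    (forall t x y, t1 <= t -> Rabs (x - px) <= W + r -> Rabs (y - py) <= W + r ->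
       c < jv V t x y) ->
    (forall x y, (x - px) * (x - px) + (y - py) * (y - py) < r * r ->
       c + delta < jv V t1 x y) ->
    c + kappa * delta < jv V (t1 + PI / 2) qx qy.
Proof.
  intros r0 W0.
  (* [L] bounds the coefficient [S] found below: [12 r W] comes from the motion of the centre,
     [12 |A| r] from the flow, and [36 = 12 + 24] from the Laplacian once [X^2 + Y^2] is replaced by
     [r^2 - z]. *)
  set (L := 12 * r * W + 12 * Rabs A * r + 36).
  pose proof (Rabs_pos A) as HA.
  assert (HL : 0 < L) by (unfold L; nra).
  set (beta := L * L / (24 * (r * r))).
  assert (Hbeta : beta * (24 * (r * r)) = L * L) by (unfold beta; field; lra).
  assert (Hbeta0 : 0 < beta) by (unfold beta; apply Rdiv_lt_0_compat; nra).
  exists (exp (- beta * (PI / 2))). split; [apply exp_pos |].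
  intros V c delta px py qx qy t1 (HV & PV & Hsup) Ht1 Hdelta Hqx Hqy Hc Hball.
  set (D := delta / (r * r * (r * r) * (r * r))).
  assert (Hr2 : 0 < r * r) by nra.
  assert (Hr6 : 0 < r * r * (r * r) * (r * r)) by (repeat apply Rmult_lt_0_compat; lra).
  assert (HD : 0 < D) by (unfold D; apply Rdiv_lt_0_compat; lra).
  assert (HDr : D * (r * r * (r * r) * (r * r)) = delta) by (unfold D; field; lra).
  set (wx := qx - px) in *. set (wy := qy - py) in *.
  assert (Hcomp : forall t x y, t1 <= t -> px - (W + r) <= x <= px + (W + r) ->
            py - (W + r) <= y <= py + (W + r) ->
            jv (moving_bump c D beta r px py wx wy t1) t x y < jv V t x y).
  { assert (Hout : forall t x y, t1 <= t -> px - (W + r) <= x <= px + (W + r) ->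
            py - (W + r) <= y <= py + (W + r) ->
            r * r - (x - (px + sin (t - t1) * wx)) * (x - (px + sin (t - t1) * wx))
                  - (y - (py + sin (t - t1) * wy)) * (y - (py + sin (t - t1) * wy)) <= 0 ->
            jv (moving_bump c D beta r px py wx wy t1) t x y < jv V t x y).
    { intros t x y Ht Hx Hy Hz.
      apply Rle_lt_trans with c; [| apply Hc; auto; apply Rabs_le; lra].
      simpl. set (z := r * r - _ - _) in *.
      pose proof (exp_pos (- beta * (t - t1))).
      assert (0 < D * exp (- beta * (t - t1))) by nra.
      assert (z * z * z <= 0) by nra. nra. }
    assert (Hsw : forall t w, Rabs w <= W -> - W <= sin (t - t1) * w <= W).
    { intros t w Hw. apply Rabs_le_between. rewrite Rabs_mult.
      pose proof (SIN_bound (t - t1)). pose proof (Rabs_pos w).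
      assert (Rabs (sin (t - t1)) <= 1) by (apply Rabs_le; lra).
      pose proof (Rabs_pos (sin (t - t1))). nra. }
    apply (comparison_box A); auto using moving_bump_regular.
    - intros x y Hx Hy.
      destruct (Rle_or_lt (r * r - (x - px) * (x - px) - (y - py) * (y - py)) 0)
        as [Hz | Hz].
      + apply Hout; auto; [lra |]. rewrite Rminus_diag, sin_0, !Rmult_0_l, !Rplus_0_r.
        exact Hz.
      + apply Rle_lt_trans with (c + delta); [| apply Hball; lra].
        simpl. rewrite Rminus_diag, sin_0, !Rmult_0_l, !Rplus_0_r, Rmult_0_r, exp_0.
        rewrite <- HDr, Rmult_1_r.
        apply Rplus_le_compat_l, Rmult_le_compat_l; [lra |].
        set (z := r * r - _ - _) in *.
        assert (Hzr : z <= r * r).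
        { unfold z. pose proof (Rle_0_sqr (x - px)). pose proof (Rle_0_sqr (y - py)).
          unfold Rsqr in *. lra. }
        assert (z * z <= r * r * (r * r)) by nra. nra.
    - intros t x y Ht Hx Hy Hb. apply Hout; auto.
      pose proof (Hsw t wx Hqx). pose proof (Hsw t wy Hqy).
      set (X := x - (px + sin (t - t1) * wx)).
      set (Y := y - (py + sin (t - t1) * wy)).
      pose proof (Rle_0_sqr X) as HX2. pose proof (Rle_0_sqr Y) as HY2.
      unfold Rsqr in *.
      assert (HXY : r * r <= X * X \/ r * r <= Y * Y).
      { destruct Hb as [-> | [-> | [-> | ->]]]; [left | left | right | right];
          unfold X, Y; nra. }
      lra.
    - intros t x y Ht Hx Hy Heq.
      destruct (Hsup t x y) as [_ Hp]; [lra |].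
      apply Rlt_le_trans with 0; [| assumption].
      specialize (Hc t x y ltac:(lra)).
      specialize (Hc ltac:(apply Rabs_le; lra) ltac:(apply Rabs_le; lra)).
      rewrite Heq in Hc. simpl in Hc. unfold heat; simpl.
      set (e := exp (- beta * (t - t1))) in *.
      set (X := x - (px + sin (t - t1) * wx)) in *.
      set (Y := y - (py + sin (t - t1) * wy)) in *.
      set (z := r * r - X * X - Y * Y) in *.
      assert (He : 0 < D * e) by (apply Rmult_lt_0_compat; [lra | apply exp_pos]).
      (* [V] exceeds [c] on the box and the bump exceeds [c] only where [z > 0], so contact happens
         inside the moving ball. *)
      assert (Hz : 0 < z).
      { apply Rnot_le_lt. intros Hz. assert (z * z * z <= 0) by nra. nra. }
      pose proof (Rle_0_sqr X) as HX2. pose proof (Rle_0_sqr Y) as HY2.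
      unfold Rsqr in *.
      assert (HXr : Rabs X <= r) by (apply Rabs_le; split; unfold z in *; nra).
      assert (HYr : Rabs Y <= r) by (apply Rabs_le; split; unfold z in *; nra).
      set (k := cos (t - t1)).
      assert (Hk : Rabs k <= 1) by (apply Rabs_le, COS_bound).
      pose proof (trig_prod_bound x y) as Hsc.
      pose proof (trig_prod_bound y x) as Hcs.
      rewrite (Rmult_comm (sin y)) in Hcs.
      assert (Hprod : forall a b B C', Rabs a <= B -> Rabs b <= C' ->
                Rabs (a * b) <= B * C').
      { intros a b B C' Ha Hb. rewrite Rabs_mult.
        apply Rmult_le_compat; auto using Rabs_pos. }
      assert (B1 : Rabs (k * (X * wx)) <= 1 * (r * W)) by auto.
      assert (B2 : Rabs (k * (Y * wy)) <= 1 * (r * W)) by auto.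
      assert (B3 : Rabs (A * (sin x * cos y * X)) <= Rabs A * (1 * r)).
      { apply Hprod; [lra | auto]. }
      assert (B4 : Rabs (A * (cos x * sin y * Y)) <= Rabs A * (1 * r)).
      { apply Hprod; [lra | auto]. }
      apply Rabs_le_between in B1. apply Rabs_le_between in B2.
      apply Rabs_le_between in B3. apply Rabs_le_between in B4.
      set (S := 6 * (k * (X * wx) + k * (Y * wy))
                - 6 * (A * (sin x * cos y * X) - A * (cos x * sin y * Y)) + 36).
      assert (HS : S <= L) by (unfold S, L; lra).
      replace (_ - _ - _) with (D * e * z * (- beta * (z * z) + S * z - 24 * (r * r))).
      2:{ unfold S. replace (24 * (r * r)) with (24 * (z + X * X + Y * Y))
            by (unfold z; ring). ring. }
      assert (- beta * (z * z) + S * z - 24 * (r * r) < 0).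
      { assert (S * z <= L * z) by (apply Rmult_le_compat_r; lra).
        (* [beta] makes the discriminant negative: multiply by [24 r^2]. *)
        assert (24 * (r * r) * (- beta * (z * z) + L * z - 24 * (r * r)) < 0).
        { replace (24 * (r * r) * (- beta * (z * z) + L * z - 24 * (r * r)))
            with (- (beta * (24 * (r * r))) * (z * z) + 24 * (r * r) * (L * z)
                  - 24 * (r * r) * (24 * (r * r))) by ring.
          rewrite Hbeta.
          pose proof (Rle_0_sqr (L * z - 12 * (r * r))). unfold Rsqr in *. nra. }
        nra. }
      assert (0 < D * e * z) by (apply Rmult_lt_0_compat; lra). nra. }
  assert (Hpi : 0 < PI) by apply PI_RGT_0.
  apply Rabs_le_between in Hqx. apply Rabs_le_between in Hqy.
  specialize (Hcomp (t1 + PI / 2) qx qy ltac:(lra)).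
  specialize (Hcomp ltac:(unfold wx in *; lra) ltac:(unfold wy in *; lra)).
  simpl in Hcomp. replace (t1 + PI / 2 - t1) with (PI / 2) in Hcomp by ring.
  rewrite sin_PI2 in Hcomp.
  replace (qx - (px + 1 * wx)) with 0 in Hcomp by (unfold wx; ring).
  replace (qy - (py + 1 * wy)) with 0 in Hcomp by (unfold wy; ring).
  rewrite Rmult_0_l, !Rminus_0_r in Hcomp. rewrite <- HDr.
  eapply Rle_lt_trans; [right | exact Hcomp]. ring.
Qed.

(** * The ignited cell *)

Definition cell_barrier (B q eta : R) : jet :=
  let g x y := 1 + eta - sin x * sin y in
  let E x y := exp (- q * ln (g x y)) in
  Jet
  (fun _ x y => B * (E x y - 1))
  (fun _ _ _ => 0)
  (fun _ x y => B * q * E x y / g x y * (cos x * sin y))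
  (fun _ x y => B * q * E x y / g x y * (sin x * cos y))
  (fun _ x y => B * q * E x y / (g x y * g x y)
     * ((q + 1) * (cos x * sin y * (cos x * sin y)) - sin x * sin y * g x y))
  (fun _ x y => B * q * E x y / (g x y * g x y)
     * ((q + 1) * (sin x * cos y * (sin x * cos y)) - sin x * sin y * g x y)).

Lemma sin_prod_le_1 (x y : R) : sin x * sin y <= 1.
Proof.
  pose proof (SIN_bound x). pose proof (SIN_bound y). nra.
Qed.

Lemma cell_barrier_regular (B q eta : R) : 0 < eta -> regular (cell_barrier B q eta).
Proof.
  intros Heta t x y Ht. simpl.
  assert (Hg : 0 < 1 + eta - sin x * sin y) by (pose proof (sin_prod_le_1 x y); lra).
  refine (conj _ (conj _ (conj _ (conj _ (conj _ _))))).
  1-5: auto_derive; [repeat split; (exact Hg || exact (Rgt_not_eq _ _ Hg)) |].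
  all: try (unfold Rminus in *; field; lra).
  repeat cont3_step.
  apply (cont3_comp ln (fun _ x y => 1 + eta - sin x * sin y)).
  - apply (ex_derive_continuous ln). auto_derive. exact Hg.
  - repeat cont3_step.
Qed.

(** With [a = sin x] and [b = sin y] the right side is [a^2 + b^2 - 2 a^2 b^2], and the two sides
    differ by [(a - b)^2]. *)
Lemma grad_stream_bound (x y : R) :
  2 * (sin x * sin y) * (1 - sin x * sin y) <=
  cos x * sin y * (cos x * sin y) + sin x * cos y * (sin x * cos y).
Proof.
  pose proof (sin2_cos2 x) as Hx. pose proof (sin2_cos2 y) as Hy.
  pose proof (Rle_0_sqr (sin x - sin y)) as H. unfold Rsqr in *.
  replace (_ + _) with
    ((cos x * cos x) * (sin y * sin y) + (sin x * sin x) * (cos y * cos y)) by ring.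
  replace (cos x * cos x) with (1 - sin x * sin x) by lra.
  replace (cos y * cos y) with (1 - sin y * sin y) by lra. nra.
Qed.

(** The gradient of the barrier is parallel to that of [h], so advection vanishes, and
    [Delta h = - 2 h]. Writing [1 - h = g - eta] in the gradient bound leaves the factor [(q + 1) (g
    - eta) - g = q g - (q + 1) eta]. *)
Lemma cell_barrier_heat (A B q eta t x y : R) : 0 < eta -> 0 < B -> 0 < q ->
  0 <= sin x * sin y ->
  heat A (cell_barrier B q eta) t x y <=
    - (2 * (sin x * sin y) * (B * q * exp (- q * ln (1 + eta - sin x * sin y))
        / ((1 + eta - sin x * sin y) * (1 + eta - sin x * sin y))))
      * (q * (1 + eta - sin x * sin y) - (q + 1) * eta).
Proof.
  intros Heta HB Hq Hh. pose proof (sin_prod_le_1 x y) as Hh1.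
  pose proof (grad_stream_bound x y) as Hgrad.
  unfold heat; simpl. set (h := sin x * sin y) in *.
  set (g := 1 + eta - h). assert (Hg : 0 < g) by (unfold g; lra).
  pose proof (exp_pos (- q * ln g)) as HE. set (E := exp (- q * ln g)) in *.
  set (P := B * q * E / (g * g)).
  assert (HP : 0 < P).
  { unfold P. apply Rdiv_lt_0_compat; repeat apply Rmult_lt_0_compat; lra. }
  match goal with |- ?lhs <= _ => replace lhs with
    (- (P * ((q + 1) * (cos x * sin y * (cos x * sin y) + sin x * cos y * (sin x * cos y))
       - 2 * h * g))) by ring end.
  replace (- (2 * h * P) * (q * g - (q + 1) * eta))
    with (- (P * ((q + 1) * (2 * h * (1 - h)) - 2 * h * g))) by (unfold g; ring).
  apply Ropp_le_contravar, Rmult_le_compat_l; [lra |].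
  apply Rplus_le_compat_r, Rmult_le_compat_l; lra.
Qed.

Lemma cos_ge_quadratic (u : R) : 1 - u * u / 2 <= cos u.
Proof.
  replace u with (2 * (u / 2)) at 3 by field. rewrite cos_2a_sin.
  set (v := u / 2). replace (u * u / 2) with (2 * (v * v)) by (unfold v; field).
  assert (Hpos : forall w, 0 < w -> sin w * sin w <= w * w).
  { intros w Hw. pose proof (sin_lt_x w Hw). pose proof (SIN_bound w).
    pose proof PI2_1. destruct (Rle_or_lt w 1) as [Hw1 | Hw1].
    - pose proof (sin_ge_0 w ltac:(lra) ltac:(lra)). nra.
    - nra. }
  assert (sin v * sin v <= v * v); [| lra].
  destruct (Rtotal_order v 0) as [H | [-> | H]]; [| rewrite sin_0; lra | now apply Hpos].
  specialize (Hpos (- v) ltac:(lra)). rewrite sin_neg in Hpos. lra.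
Qed.

Lemma ln_le_mono (a b : R) : 0 < a -> a <= b -> ln a <= ln b.
Proof.
  intros Ha [H | ->]; [left; now apply ln_increasing | lra].
Qed.

Lemma exp_le_mono (a b : R) : a <= b -> exp a <= exp b.
Proof.
  intros [H | ->]; [left; now apply exp_increasing | lra].
Qed.

(* The profile stays above [th'] on the whole range of [g] in which the barrier fails
   to be a subsolution of the linear equation, i.e. for [g <= (1 + 1/q) eta].  With
   [eta = 2^(-1/q)] its maximum is [th1], while [q ln (1 + 1/q) -> 0] as [q -> 0]. *)
Lemma barrier_parameters (th' th1 : R) : 0 < th' < th1 ->
  exists q eta, 0 < q /\ 0 < eta < 1 /\ exp (- q * ln eta) = 2 /\
    th' <= th1 * (exp (- q * ln ((q + 1) / q * eta)) - 1).
Proof.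
  (* The loss [2 eps th1] equals [th1 - th']. The choice of [q] gives [1 + 1/q = 1 + j^2/4 <= (1 +
     j/2)^2 <= exp j] and [q j = eps], hence [q ln (1 + 1/q) <= eps]. *)
  intros Hth. set (eps := (th1 - th') / (2 * th1)).
  assert (Heps : 0 < eps) by (unfold eps; apply Rdiv_lt_0_compat; lra).
  set (j := 4 / eps). assert (Hj : 0 < j) by (unfold j; apply Rdiv_lt_0_compat; lra).
  set (q := 4 / (j * j)).
  assert (Hq : 0 < q) by (unfold q; apply Rdiv_lt_0_compat; nra).
  pose proof ln_lt_2 as Hln2.
  assert (Hl : ln (exp (- (ln 2 / q))) = - (ln 2 / q)) by apply ln_exp.
  assert (HK : (q + 1) / q <= exp j).
  { replace ((q + 1) / q) with (1 + j * j / 4) by (unfold q; field; lra).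
    replace j with (j / 2 + j / 2) at 3 by field. rewrite exp_plus.
    pose proof (exp_ineq1_le (j / 2)). nra. }
  assert (HK0 : 0 < (q + 1) / q) by (apply Rdiv_lt_0_compat; lra).
  exists q, (exp (- (ln 2 / q))).
  split; [assumption |]. split; [split; [apply exp_pos |] | split].
  - rewrite <- exp_0. apply exp_increasing.
    assert (0 < ln 2 / q) by (apply Rdiv_lt_0_compat; lra). lra.
  - rewrite Hl. replace (- q * - (ln 2 / q)) with (ln 2) by (field; lra).
    apply exp_ln. lra.
  - rewrite ln_mult, Hl by (assumption || apply exp_pos).
    replace (- q * (ln ((q + 1) / q) + - (ln 2 / q)))
      with (- q * ln ((q + 1) / q) + ln 2) by (field; lra).
    rewrite exp_plus, exp_ln by lra.
    assert (HlnK : ln ((q + 1) / q) <= j).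
    { rewrite <- (ln_exp j). now apply ln_le_mono. }
    pose proof (exp_ineq1_le (- q * ln ((q + 1) / q))) as H.
    assert (Hqj : q * j = eps) by (unfold q, j; field; lra).
    assert (q * ln ((q + 1) / q) <= eps) by (rewrite <- Hqj; apply Rmult_le_compat_l; lra).
    assert (Hthe : th1 * eps = (th1 - th') / 2) by (unfold eps; field; lra).
    nra.
Qed.

Definition reaction_solution (m : R) (f : R -> R) (A : R) (V : jet) : Prop :=
  regular V /\ y_periodic (jv V) /\
  forall t x y, 0 < t ->
    0 <= jv V t x y <= 1 /\ heat A V t x y = m * f (jv V t x y).

(* For data equal to 1 on [0, PI]^2; the limit [t -> 0] is locally uniform in the open cell. *)
Definition ignited_cell (V : jet) : Prop :=
  forall x y, 0 < x < PI -> 0 < y < PI -> forall eps, 0 < eps ->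
    exists d, 0 < d /\ forall t x' y', 0 < t < d ->
      Rabs (x' - x) < d -> Rabs (y' - y) < d -> 1 - eps < jv V t x' y'.

Lemma ignition_nonneg (f : R -> R) (s : R) : ignition f -> 0 <= s <= 1 -> 0 <= f s.
Proof.
  intros (_ & f1 & (th0 & Hth & f0 & fpos) & _) Hs.
  destruct (Rle_or_lt s th0) as [H | H]; [rewrite f0; lra |].
  destruct (Req_dec s 1) as [-> | Hs1]; [lra | left; apply fpos; lra].
Qed.

Lemma ignition_lower_bound (f : R -> R) (a b : R) : ignition f -> 0 <= a -> b <= 1 ->
  (forall s, a <= s <= b -> 0 < f s) ->
  exists d, 0 < d /\ forall s, a <= s <= b -> d <= f s.
Proof.
  intros ((L & HL) & _) Ha Hb Hpos.
  destruct (interval_uniform (fun d s => a <= s <= b -> d <= f s) a b)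
    as (d & d0 & Hd).
  - intros d d' x Hd H Hx. specialize (H Hx). lra.
  - intros x Hx. pose proof (Hpos x Hx) as Hfx. pose proof (Rabs_pos L) as HL0.
    (* One number serves as radius and as lower bound: within distance [d] of [x], [f] loses at most
       [|L| d] out of [2 (|L| + 1) d]. *)
    exists (f x / (2 * (Rabs L + 1))).
    split; [apply Rdiv_lt_0_compat; lra |]. intros x' Hx' Hxab.
    specialize (HL x' x ltac:(lra) ltac:(lra)). apply Rabs_le_between in HL.
    set (d := f x / (2 * (Rabs L + 1))) in *.
    assert (Hd : d * (2 * (Rabs L + 1)) = f x) by (unfold d; field; lra).
    pose proof (Rle_abs L). pose proof (Rabs_pos (x' - x)).
    assert (L * Rabs (x' - x) <= Rabs L * d).
    { apply Rle_trans with (Rabs L * Rabs (x' - x));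
        [apply Rmult_le_compat_r | apply Rmult_le_compat_l]; lra. }
    nra.
  - exists d. split; auto.
Qed.

(** Where [q g > (q + 1) eta] the barrier is a strict linear subsolution and [f >= 0] suffices.
    Nearer the centre its value lies in [[th', th1]], where [f >= d], and [m d] outweighs the
    defect. Neither regime sees [A], so [m0] depends on [f] and [th0] only. *)
Lemma cell_stays_ignited (f : R -> R) (th0 : R) : ignition f -> 0 < th0 < 1 ->
  (forall s, th0 < s < 1 -> f s > 0) ->
  exists m0 th' r, 0 < m0 /\ th0 < th' /\ 0 < r /\
    forall m A V, m0 <= m -> reaction_solution m f A V -> ignited_cell V ->
      exists t0, 0 < t0 /\ forall t x y, t0 <= t ->
        (x - PI / 2) * (x - PI / 2) + (y - PI / 2) * (y - PI / 2) < r * r ->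
        th' < jv V t x y.
Proof.
  intros Hf Hth0 fpos.
  set (th' := (2 * th0 + 1) / 3). set (th1 := (th0 + 2) / 3).
  destruct (barrier_parameters th' th1) as (q & eta & Hq & Heta & HN & Hprof);
    [unfold th', th1; lra |].
  destruct (ignition_lower_bound f th' th1 Hf) as (d & d0 & Hd);
    [unfold th'; lra | unfold th1; lra | intros s Hs; apply fpos; unfold th', th1 in Hs; lra |].
  assert (Hth1 : 0 < th1 < 1) by (unfold th1; lra).
  (* [Cmax] bounds the defect [2 P g = 2 th1 q E / g], by [E <= 2] and [g >= eta]. *)
  set (Cmax := 4 * th1 * q / eta).
  assert (HCmax : 0 < Cmax).
  { unfold Cmax. apply Rdiv_lt_0_compat; [| lra]. repeat apply Rmult_lt_0_compat; lra. }
  (* On this ball [h >= 1 - r^2/2], hence [g <= (1 + 1/q) eta], where the profile is at least [th'].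
     The denominator [q + 1] also gives [r < 1], which keeps the ball inside the box used for
     comparison. *)
  set (r := sqrt (eta / (q + 1))).
  assert (Hetaq : 0 < eta / (q + 1)) by (apply Rdiv_lt_0_compat; lra).
  assert (Hq1 : eta / (q + 1) <= eta / q /\ eta / (q + 1) < 1).
  { split.
    - apply Rmult_le_compat_l; [lra |]. apply Rinv_le_contravar; lra.
    - apply Rlt_div_l; lra. }
  assert (Hr : 0 < r) by now apply sqrt_lt_R0.
  assert (Hrr : r * r = eta / (q + 1)) by (apply sqrt_sqrt; lra).
  exists ((Cmax + 1) / d), th', r.
  split; [apply Rdiv_lt_0_compat; lra |]. split; [unfold th'; lra |].
  split; [assumption |].
  intros m A V Hm (HV & PV & Heq) Hign.
  assert (Hmd : Cmax + 1 <= m * d).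
  { replace (Cmax + 1) with ((Cmax + 1) / d * d) by (field; lra).
    apply Rmult_le_compat_r; lra. }
  assert (Hmpos : 0 < m).
  { apply Rlt_le_trans with ((Cmax + 1) / d); [apply Rdiv_lt_0_compat |]; lra. }
  pose proof PI_RGT_0 as Hpi. pose proof PI2_1 as Hpi2.
  set (W := cell_barrier th1 q eta).
  assert (Hprof_mono : forall g g', 0 < g -> g <= g' ->
            exp (- q * ln g') <= exp (- q * ln g)).
  { intros g g' Hg Hgg'. apply exp_le_mono. pose proof (ln_le_mono g g' Hg Hgg'). nra. }
  assert (HE2 : forall x y, exp (- q * ln (1 + eta - sin x * sin y)) <= 2).
  { intros x y. rewrite <- HN. pose proof (sin_prod_le_1 x y).
    apply Hprof_mono; lra. }
  assert (Hneg : forall t x y, sin x * sin y < eta -> jv W t x y < 0).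
  { intros t x y Hh. simpl.
    assert (exp (- q * ln (1 + eta - sin x * sin y)) < 1).
    { apply Rlt_le_trans with (exp 0); [apply exp_increasing | rewrite exp_0; lra].
      assert (0 < ln (1 + eta - sin x * sin y)) by (rewrite <- ln_1; apply ln_increasing; lra).
      nra. }
    nra. }
  (* The datum is controlled in the open cell, so the box stays [eta / 2] away from the walls; since
     [sin (eta / 2) < eta], the barrier is negative on its sides. *)
  destruct (tube (fun s x y => 0 < s -> th1 < jv V s x y)
              (eta / 2) (PI - eta / 2) (eta / 2) (PI - eta / 2)) as (t1 & t1pos & Ht1).
  { intros x y Hx Hy.
    destruct (Hign x y ltac:(lra) ltac:(lra) (1 - th1) ltac:(lra)) as (e & e0 & He).
    exists e. split; [assumption |]. intros s x' y' Hs Hx' Hy' Hs0.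
    apply Rabs_def2 in Hs. specialize (He s x' y' ltac:(lra) Hx' Hy'). lra. }
  assert (Hcomp : forall t x y, t1 / 2 <= t -> eta / 2 <= x <= PI - eta / 2 ->
            eta / 2 <= y <= PI - eta / 2 -> jv W t x y < jv V t x y).
  { assert (Hsin_small : sin (eta / 2) < eta) by (pose proof (sin_lt_x (eta / 2)); lra).
    assert (Hsin_pos : forall z, eta / 2 <= z <= PI - eta / 2 -> 0 < sin z).
    { intros z Hz. apply sin_gt_0; lra. }
    apply (comparison_box A); auto.
    - lra.
    - apply cell_barrier_regular. lra.
    - intros x y Hx Hy. apply Rle_lt_trans with th1.
      + specialize (HE2 x y). simpl. nra.
      + apply Ht1; auto; [apply Rabs_def1; lra | lra].
    - intros t x y Ht Hx Hy Hb. destruct (Heq t x y ltac:(lra)) as [Hv _].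
      apply Rlt_le_trans with 0; [| lra]. apply Hneg.
      pose proof (Hsin_pos x Hx). pose proof (Hsin_pos y Hy).
      pose proof (SIN_bound x). pose proof (SIN_bound y).
      assert (Hsy : sin (PI - eta / 2) = sin (eta / 2)) by apply sin_PI_x.
      destruct Hb as [-> | [-> | [-> | ->]]]; rewrite ?Hsy in *; nra.
    - intros t x y Ht Hx Hy Htouch. destruct (Heq t x y ltac:(lra)) as [Hv ->].
      assert (Hh : eta <= sin x * sin y).
      { apply Rnot_lt_le. intros Hh. pose proof (Hneg t x y Hh). lra. }
      pose proof (cell_barrier_heat A th1 q eta t x y ltac:(lra) ltac:(lra) Hq ltac:(lra))
        as Hheat.
      fold W in Hheat. pose proof (sin_prod_le_1 x y) as Hh1.
      specialize (HE2 x y). rewrite Htouch in Hv |- *.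
      change (jv W t x y) with
        (th1 * (exp (- q * ln (1 + eta - sin x * sin y)) - 1)) in *.
      set (h := sin x * sin y) in *. set (g := 1 + eta - h) in *.
      assert (Hg : eta <= g) by (unfold g; lra).
      pose proof (exp_pos (- q * ln g)) as HE.
      set (E := exp (- q * ln g)) in *.
      set (P := th1 * q * E / (g * g)) in *.
      assert (HP : 0 < P).
      { unfold P. apply Rdiv_lt_0_compat; repeat apply Rmult_lt_0_compat; lra. }
      destruct (Rlt_or_le ((q + 1) * eta) (q * g)) as [Hfar | Hnear].
      + assert (0 <= m * f (th1 * (E - 1))).
        { apply Rmult_le_pos; [lra | now apply ignition_nonneg]. }
        assert (0 < 2 * h * P * (q * g - (q + 1) * eta)).
        { apply Rmult_lt_0_compat; [apply Rmult_lt_0_compat |]; lra. }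
        lra.
      + assert (HgK : g <= (q + 1) / q * eta).
        { apply Rmult_le_reg_l with q; [assumption |].
          replace (q * ((q + 1) / q * eta)) with ((q + 1) * eta) by (field; lra).
          assumption. }
        assert (Hval : th' <= th1 * (E - 1) <= th1).
        { split; [| nra]. eapply Rle_trans; [exact Hprof |].
          apply Rmult_le_compat_l; [lra |]. apply Rplus_le_compat_r.
          apply Hprof_mono; lra. }
        specialize (Hd _ Hval).
        assert (m * d <= m * f (th1 * (E - 1))) by (apply Rmult_le_compat_l; lra).
        assert (HPC : 2 * P * g <= Cmax).
        { unfold P, Cmax. replace (2 * (th1 * q * E / (g * g)) * g)
            with (2 * th1 * q * (E / g)) by (field; lra).
          replace (4 * th1 * q / eta) with (2 * th1 * q * (2 / eta)) by (field; lra).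
          apply Rmult_le_compat_l; [repeat apply Rmult_le_pos; lra |].
          apply Rmult_le_compat; [lra | left; apply Rinv_0_lt_compat; lra | assumption |].
          apply Rinv_le_contravar; lra. }
        assert (- (2 * h * P) * (q * g - (q + 1) * eta) <= 2 * P * g); [| lra].
        replace (- (2 * h * P) * (q * g - (q + 1) * eta))
          with (2 * P * (h * ((q + 1) * eta - q * g))) by ring.
        replace (2 * P * g) with (2 * P * (1 * g)) by ring.
        apply Rmult_le_compat_l; [lra |].
        assert ((q + 1) * eta - q * g <= g) by nra. nra. }
  exists (t1 / 2). split; [lra |]. intros t x y Ht Hball.
  set (a := x - PI / 2) in *. set (b := y - PI / 2) in *.
  assert (Hsin : forall u, sin (u + PI / 2) = cos u).
  { intros u. rewrite sin_plus, sin_PI2, cos_PI2. ring. }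
  assert (Hh : 1 - (a * a + b * b) / 2 <= sin x * sin y).
  { replace x with (a + PI / 2) by (unfold a; ring).
    replace y with (b + PI / 2) by (unfold b; ring). rewrite !Hsin.
    pose proof (cos_ge_quadratic (a + b)) as H1. pose proof (cos_ge_quadratic (a - b)) as H2.
    rewrite cos_plus in H1. rewrite cos_minus in H2. lra. }
  pose proof (sin_prod_le_1 x y) as Hh1.
  assert (Hxy : eta / 2 <= x <= PI - eta / 2 /\ eta / 2 <= y <= PI - eta / 2).
  { pose proof PI2_3_2. assert (-1 < a < 1 /\ -1 < b < 1) by (repeat split; nra).
    unfold a, b in *. lra. }
  destruct Hxy as [Hx Hy].
  specialize (Hcomp t x y Ht Hx Hy).
  eapply Rle_lt_trans; [| exact Hcomp]. eapply Rle_trans; [exact Hprof |].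
  simpl. apply Rmult_le_compat_l; [lra |]. apply Rplus_le_compat_r.
  apply Hprof_mono; [lra |].
  replace ((q + 1) / q * eta) with (eta + eta / q) by (field; lra). lra.
Qed.

(** * The asymptotic level *)

(** Increments of a concave sequence do not increase, so a single drop by [d] would repeat forever
    and break the lower bound. *)
Lemma bounded_concave_nondecreasing (a : Z -> R) (lo : R) :
  (forall k, lo <= a k) ->
  (forall k, a (k - 1)%Z + a (k + 1)%Z <= 2 * a k) ->
  forall k, a k <= a (k + 1)%Z.
Proof.
  intros Hlo Hconc k. apply Rnot_lt_le. intros Hk.
  set (d := a k - a (k + 1)%Z) in *.
  assert (Hstep : forall n : nat,
            a (k + Z.of_nat n + 1)%Z <= a (k + Z.of_nat n)%Z - d /\
            a (k + Z.of_nat n)%Z <= a k - INR n * d).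
  { induction n as [|n [IH1 IH2]].
    - simpl. rewrite Z.add_0_r. unfold d. lra.
    - rewrite S_INR, Nat2Z.inj_succ.
      specialize (Hconc (k + Z.succ (Z.of_nat n))%Z).
      replace (k + Z.succ (Z.of_nat n) - 1)%Z with (k + Z.of_nat n)%Z in Hconc by lia.
      replace (k + Z.succ (Z.of_nat n))%Z with (k + Z.of_nat n + 1)%Z in * by lia.
      lra. }
  assert (Hd : 0 < d) by (unfold d; lra).
  destruct (INR_unbounded ((a k - lo) / d)) as [n Hn].
  destruct (Hstep n) as [_ H]. specialize (Hlo (k + Z.of_nat n)%Z).
  assert (a k - lo < INR n * d); [| lra].
  replace (a k - lo) with ((a k - lo) / d * d) by (field; lra).
  apply Rmult_lt_compat_r; lra.
Qed.

Lemma bounded_concave_constant (a : Z -> R) (lo : R) :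
  (forall k, lo <= a k) ->
  (forall k, a (k - 1)%Z + a (k + 1)%Z <= 2 * a k) ->
  forall k, a k = a 0%Z.
Proof.
  intros Hlo Hconc.
  assert (Hsucc : forall k, a (k + 1)%Z = a k).
  { intros k. apply Rle_antisym.
    - pose proof (bounded_concave_nondecreasing (fun k => a (- k)%Z) lo) as H.
      specialize (H ltac:(intros; apply Hlo)).
      specialize (H ltac:(intros j; cbv beta; specialize (Hconc (- j)%Z);
        replace (- (j - 1))%Z with (- j + 1)%Z by lia;
        replace (- (j + 1))%Z with (- j - 1)%Z by lia; lra)).
      specialize (H (- (k + 1))%Z). cbv beta in H.
      replace (- - (k + 1))%Z with (k + 1)%Z in H by lia.
      replace (- (- (k + 1) + 1))%Z with k in H by lia. exact H.
    - now apply (bounded_concave_nondecreasing a lo). }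
  intros k. induction k as [|k IH|k IH] using Z.peano_ind.
  - reflexivity.
  - now rewrite <- Z.add_1_r, Hsucc.
  - rewrite <- IH, <- (Hsucc (Z.pred k)). f_equal. lia.
Qed.

Definition eventually_above (V : jet) (k : Z) (c : R) : Prop :=
  exists t1, 0 < t1 /\ forall t y, t1 <= t -> c < jv V t (IZR k * PI) y.

(** Each [a k] is the supremum of the bounds that eventually hold on wall [k]. Constancy in [k]
    matters because two far walls [k] and [- k] then carry the same bound, and relaxation between
    them spreads it over any compact set. The last conclusion, maximality on the wall [x = 0], is
    the one contradicted later. *)
Lemma asymptotic_level (A : R) (V : jet) :
  supersolution A V -> (forall t x y, 0 < t -> jv V t x y <= 1) ->
  exists a, a <= 1 /\
    (forall c X, c < a -> exists t1, 0 < t1 /\ forall t x y, t1 <= t ->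
       - X <= x <= X -> c < jv V t x y) /\
    (forall c, eventually_above V 0 c -> c <= a).
Proof.
  intros HV Hle1. pose proof HV as (HVr & PV & Hsup).
  assert (Hlub : forall k, {m | is_lub (eventually_above V k) m}).
  { intros k. apply completeness.
    - exists 1. intros c (t1 & Ht1 & H). specialize (H t1 0 (Rle_refl t1)).
      specialize (Hle1 t1 (IZR k * PI) 0 Ht1). lra.
    (* The bound is strict and [V] is only known to be nonnegative, hence [-1] and not 0. *)
    - exists (-1). exists 1. split; [lra |]. intros t y Ht.
      destruct (Hsup t (IZR k * PI) y ltac:(lra)). lra. }
  set (a := fun k => proj1_sig (Hlub k)).
  assert (Ha : forall k, is_lub (eventually_above V k) (a k)).
  { intros k. exact (proj2_sig (Hlub k)). }
  assert (Hbelow : forall k c, c < a k -> eventually_above V k c).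
  { intros k c Hc. apply NNPP. intros Hn. apply (Rlt_not_le _ _ Hc).
    apply (proj2 (Ha k)). intros c' (t1 & Ht1 & H). apply Rnot_lt_le. intros Hcc'.
    apply Hn. exists t1. split; [assumption |]. intros t y Ht.
    specialize (H t y Ht). lra. }
  assert (Habove : forall k c, eventually_above V k c -> c <= a k).
  { intros k. exact (proj1 (Ha k)). }
  assert (Hmin : forall k, -1 <= a k).
  { intros k. apply Habove. exists 1. split; [lra |]. intros t y Ht.
    destruct (Hsup t (IZR k * PI) y ltac:(lra)). lra. }
  assert (Hconc : forall k, a (k - 1)%Z + a (k + 1)%Z <= 2 * a k).
  { intros k. apply Rnot_lt_le. intros Hlt.
    (* The concavity defect is halved by averaging to [4 eps], of which only [2 eps] is lost: once
       on the walls, once in the relaxation. *)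
    set (eps := (a (k - 1)%Z + a (k + 1)%Z - 2 * a k) / 8).
    assert (Heps : 0 < eps) by (unfold eps; lra).
    destruct (Hbelow (k - 1)%Z (a (k - 1)%Z - eps) ltac:(lra)) as (t1 & Ht1 & H1).
    destruct (Hbelow (k + 1)%Z (a (k + 1)%Z - eps) ltac:(lra)) as (t2 & Ht2 & H2).
    set (p := IZR k * PI).
    assert (Hp : sin p = 0) by (apply sin_eq_0_1; now exists k).
    rewrite minus_IZR in H1. rewrite plus_IZR in H2.
    replace ((IZR k - 1) * PI) with (p - PI) in H1 by (unfold p; ring).
    replace ((IZR k + 1) * PI) with (p + PI) in H2 by (unfold p; ring).
    pose proof (Rmax_l t1 t2). pose proof (Rmax_r t1 t2).
    (* The average takes on both walls [p - PI] and [p + PI] the mean of the two values of [V], and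
       it coincides with [V] on [x = p]. *)
    destruct (strip_relaxation A (mirror_mean V p) (Rmax t1 t2) (p - PI) (p + PI)
                ((a (k - 1)%Z + a (k + 1)%Z) / 2 - eps) eps) as (t3 & Ht3 & H3).
    - now apply mirror_mean_supersolution.
    - lra.
    - assumption.
    - intros t y Ht. simpl. replace (2 * p - (p - PI)) with (p + PI) by ring.
      specialize (H1 t y ltac:(lra)). specialize (H2 t y ltac:(lra)). lra.
    - intros t y Ht. simpl. replace (2 * p - (p + PI)) with (p - PI) by ring.
      specialize (H1 t y ltac:(lra)). specialize (H2 t y ltac:(lra)). lra.
    - assert (Hk : eventually_above V k ((a (k - 1)%Z + a (k + 1)%Z) / 2 - eps - eps)).
      { exists t3. split; [lra |]. intros t y Ht. pose proof PI_RGT_0.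
        specialize (H3 t p y Ht ltac:(lra)). simpl in H3.
        replace (2 * p - p) with p in H3 by ring. fold p. lra. }
      apply Habove in Hk. unfold eps in *. lra. }
  pose proof (bounded_concave_constant a (-1) Hmin Hconc) as Hconst.
  exists (a 0%Z). split; [| split].
  - apply (proj2 (Ha 0%Z)). intros c (t1 & Ht1 & H). specialize (H t1 0 (Rle_refl t1)).
    specialize (Hle1 t1 (IZR 0 * PI) 0 Ht1). lra.
  - intros c X Hc. pose proof PI_RGT_0 as Hpi.
    set (k := up (X / PI)). destruct (archimed (X / PI)) as [Hk _]. fold k in Hk.
    assert (HX : X < IZR k * PI).
    { replace X with (X / PI * PI) by (field; lra). apply Rmult_lt_compat_r; lra. }
    set (c' := (c + a 0%Z) / 2). assert (Hcc' : c < c' < a 0%Z) by (unfold c'; lra).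
    destruct (Hbelow k c' ltac:(rewrite Hconst; lra)) as (t1 & Ht1 & H1).
    destruct (Hbelow (- k)%Z c' ltac:(rewrite Hconst; lra)) as (t2 & Ht2 & H2).
    rewrite opp_IZR in H2.
    pose proof (Rmax_l t1 t2). pose proof (Rmax_r t1 t2).
    destruct (strip_relaxation A V (Rmax t1 t2) (- IZR k * PI) (IZR k * PI) c' (c' - c))
      as (t3 & Ht3 & H3); auto; try lra.
    + intros t y Ht. apply H2. lra.
    + intros t y Ht. apply H1. lra.
    + exists t3. split; [lra |]. intros t x y Ht Hx.
      specialize (H3 t x y Ht ltac:(lra)). lra.
  - intros c Hc. now apply Habove.
Qed.

(** * Excluding levels below one *)

Definition ramp_barrier (c d t1 : R) : jet := Jet
  (fun t x _ => c + d * (1 - exp (- (t - t1))) * cos (x / 2))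
  (fun t x _ => d * exp (- (t - t1)) * cos (x / 2))
  (fun t x _ => - (d * (1 - exp (- (t - t1))) * sin (x / 2) / 2))
  (fun _ _ _ => 0)
  (fun t x _ => - (d * (1 - exp (- (t - t1))) * cos (x / 2) / 4))
  (fun _ _ _ => 0).

Lemma ramp_barrier_regular (c d t1 : R) : regular (ramp_barrier c d t1).
Proof.
  intros t x y Ht. simpl.
  refine (conj _ (conj _ (conj _ (conj _ (conj _ _))))).
  1-5: auto_derive; [repeat split | unfold Rminus, Rdiv; field].
  repeat cont3_step. apply (cont3_mult (fun _ x _ => x) (fun _ _ _ => / 2)); cont3_step.
Qed.

(** Just below the level [a] the reaction is at least [m d], which pays for slowly raising a hump
    [cos (x / 2)]. The hump vanishes on [x = - PI] and [x = PI], where the bound [c] is already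
    available. *)
Lemma no_intermediate_level (f : R -> R) (m A : R) (V : jet) (a b : R) :
  ignition f -> 0 < m -> reaction_solution m f A V ->
  0 <= b < a -> a < 1 -> (forall s, b < s < 1 -> f s > 0) ->
  (forall c, c < a -> exists t1, 0 < t1 /\ forall t x y, t1 <= t ->
       - PI <= x <= PI -> c < jv V t x y) ->
  exists c, a < c /\ eventually_above V 0 c.
Proof.
  intros Hf Hm (HV & PV & Heq) Hb Ha fpos Hlevel.
  set (lo := (a + b) / 2). set (hi := (a + 1) / 2).
  destruct (ignition_lower_bound f lo hi Hf) as (d & d0 & Hd);
    [unfold lo; lra | unfold hi; lra | intros s Hs; apply fpos; unfold lo, hi in Hs; lra |].
  pose proof (Rabs_pos A) as HA.
  (* The first bound keeps the ramp below [hi]; the second pays for time derivative, drift and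
     Laplacian of the ramp, together less than [delta (3 + |A|)]. *)
  set (delta := Rmin ((1 - a) / 2) (m * d / (3 + Rabs A))).
  assert (Hmd : 0 < m * d) by (apply Rmult_lt_0_compat; lra).
  assert (Hdelta : 0 < delta).
  { apply Rmin_glb_lt; [lra | apply Rdiv_lt_0_compat; lra]. }
  assert (Hdelta1 : delta <= (1 - a) / 2) by apply Rmin_l.
  assert (Hdelta2 : delta * (3 + Rabs A) <= m * d).
  { replace (m * d) with (m * d / (3 + Rabs A) * (3 + Rabs A)) by (field; lra).
    apply Rmult_le_compat_r; [lra | apply Rmin_r]. }
  set (c := Rmax lo (a - delta / 4)).
  assert (Hc : lo <= c /\ a - delta / 4 <= c /\ c < a).
  { unfold c. repeat split; [apply Rmax_l | apply Rmax_r |].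
    apply Rmax_lub_lt; unfold lo; lra. }
  destruct (Hlevel c ltac:(lra)) as (t1 & Ht1 & H1).
  pose proof PI_RGT_0 as Hpi.
  assert (Hcomp : forall t x y, t1 <= t -> - PI <= x <= PI ->
            jv (ramp_barrier c delta t1) t x y < jv V t x y).
  { apply (comparison_strip A); auto using ramp_barrier_regular.
    - intros t x y Ht. reflexivity.
    - intros x y Hx. simpl. rewrite Rminus_diag, Ropp_0, exp_0, Rminus_diag.
      rewrite Rmult_0_r, Rmult_0_l, Rplus_0_r. apply H1; lra.
    - intros t y Ht. simpl. replace (- PI / 2) with (- (PI / 2)) by field.
      rewrite cos_neg, cos_PI2, Rmult_0_r, Rplus_0_r. apply H1; lra.
    - intros t y Ht. simpl.
      rewrite cos_PI2, Rmult_0_r, Rplus_0_r. apply H1; lra.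
    - intros t x y Ht Hx Htouch. destruct (Heq t x y ltac:(lra)) as [Hv ->].
      assert (Hcos : 0 < cos (x / 2)) by (apply cos_gt_0; lra).
      pose proof (COS_bound (x / 2)) as Hcos1.
      assert (He : 0 < exp (- (t - t1)) < 1).
      { split; [apply exp_pos |]. rewrite <- exp_0. apply exp_increasing. lra. }
      rewrite Htouch. unfold heat. simpl.
      set (e := exp (- (t - t1))) in *. set (k := cos (x / 2)) in *.
      assert (Hek : 0 <= (1 - e) * k <= 1) by (split; nra).
      assert (Hval : lo <= c + delta * (1 - e) * k <= hi).
      { rewrite Rmult_assoc. unfold hi. nra. }
      specialize (Hd _ Hval).
      apply Rlt_le_trans with (m * d); [| apply Rmult_le_compat_l; lra].
      assert (Hadv : A * (sin x * cos y * - ((1 - e) * sin (x / 2) / 2)) <= Rabs A * 1).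
      { apply Rmult_abs_le. rewrite Rabs_mult.
        pose proof (trig_prod_bound x y). pose proof (Rabs_pos (sin x * cos y)).
        assert (Rabs (- ((1 - e) * sin (x / 2) / 2)) <= 1).
        { pose proof (SIN_bound (x / 2)). apply Rabs_le. split; nra. }
        pose proof (Rabs_pos (- ((1 - e) * sin (x / 2) / 2))). nra. }
      match goal with |- ?lhs < _ => replace lhs with
        (delta * (e * k + A * (sin x * cos y * - ((1 - e) * sin (x / 2) / 2))
           + (1 - e) * k / 4)) by field end.
      apply Rlt_le_trans with (delta * (3 + Rabs A)); [| assumption].
      apply Rmult_lt_compat_l; [assumption |]. nra. }
  (* From [t1 + 1] on, at least half of the ramp has risen, and [c >= a - delta / 4]. *)
  exists (c + delta / 2). split; [lra |].
  exists (t1 + 1). split; [lra |]. intros t y Ht.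
  specialize (Hcomp t 0 y ltac:(lra) ltac:(lra)). simpl in Hcomp.
  rewrite Rmult_0_l. replace (0 / 2) with 0 in Hcomp by field. rewrite cos_0 in Hcomp.
  assert (exp (- (t - t1)) <= / 2).
  { rewrite exp_Ropp. apply Rinv_le_contravar; [lra |].
    pose proof (exp_ineq1_le (t - t1)). lra. }
  nra.
Qed.

(** For each late time [t] a separate bump is launched at [t - PI / 2] from the ball. The bound [c]
    lies only [kappa delta / 2] below [a], half of what the bump gains. *)
Lemma ignited_ball_raises_level (A : R) (V : jet) (a th r t0 : R) :
  supersolution A V -> 0 < r -> 0 < t0 -> a < th ->
  (forall t x y, t0 <= t ->
     (x - PI / 2) * (x - PI / 2) + (y - PI / 2) * (y - PI / 2) < r * r ->
     th < jv V t x y) ->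
  (forall c X, c < a -> exists t1, 0 < t1 /\ forall t x y, t1 <= t ->
       - X <= x <= X -> c < jv V t x y) ->
  exists c, a < c /\ eventually_above V 0 c.
Proof.
  intros HV r0 Ht0 Hath Hball Hlevel. pose proof PI_RGT_0 as Hpi.
  (* The reach [2 PI] covers the way from the cell centre to any point of [x = 0] with [y] in one
     period. *)
  destruct (moving_bump_positivity A r (2 * PI) r0 ltac:(lra)) as (kappa & Hk & Hbump).
  set (delta := th - a). assert (Hdelta : 0 < delta) by (unfold delta; lra).
  assert (Hkd : 0 < kappa * delta) by (apply Rmult_lt_0_compat; lra).
  set (c := a - kappa * delta / 2).
  destruct (Hlevel c (3 * PI + r) ltac:(unfold c; lra)) as (t1 & Ht1 & H1).
  exists (c + kappa * delta). split; [unfold c; lra |].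
  exists (Rmax t0 t1 + PI / 2). pose proof (Rmax_l t0 t1). pose proof (Rmax_r t0 t1).
  split; [lra |]. intros t y Ht. rewrite Rmult_0_l.
  pose proof HV as (_ & PV & _).
  destruct (y_periodic_fundamental (jv V) t y PV ltac:(lra)) as (y' & Hy' & ->).
  replace t with (t - PI / 2 + PI / 2) by ring.
  apply (Hbump V c delta (PI / 2) (PI / 2)); try lra.
  - assumption.
  - apply Rabs_le. lra.
  - apply Rabs_le. lra.
  - intros s x z Hs Hx Hz. apply Rabs_le_between in Hx. apply H1; lra.
  - intros x z Hxz. apply Rle_lt_trans with th; [unfold c, delta in *; lra |].
    apply Hball; [lra | assumption].
Qed.

(** Maximality of the level [a] is used twice: the bump excludes [a < th'], and then
    [th0 < th' <= a < 1] is excluded by the reaction. *)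
Lemma convergence_to_one (f : R -> R) (th0 : R) : ignition f -> 0 < th0 < 1 ->
  (forall s, th0 < s < 1 -> f s > 0) ->
  exists m0, 0 < m0 /\ forall m A V, m0 <= m ->
    reaction_solution m f A V -> ignited_cell V ->
    forall c X, c < 1 -> exists t1, 0 < t1 /\ forall t x y, t1 <= t ->
      - X <= x <= X -> c < jv V t x y.
Proof.
  intros Hf Hth0 fpos.
  destruct (cell_stays_ignited f th0 Hf Hth0 fpos)
    as (m0 & th' & r & Hm0 & Hth' & Hr & Hcell).
  exists m0. split; [assumption |]. intros m A V Hm HR Hign.
  destruct (Hcell m A V Hm HR Hign) as (t0 & Ht0 & Hball).
  pose proof HR as (HV & PV & Heq).
  assert (HS : supersolution A V).
  { split; [assumption | split; [assumption |]]. intros t x y Ht.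
    destruct (Heq t x y Ht) as [Hv ->]. split; [lra |].
    apply Rmult_le_pos; [lra | now apply ignition_nonneg]. }
  destruct (asymptotic_level A V HS) as (a & Ha1 & Hlevel & Hmax).
  { intros t x y Ht. apply Heq; assumption. }
  assert (Hath : th' <= a).
  { apply Rnot_lt_le. intros Hlt.
    destruct (ignited_ball_raises_level A V a th' r t0) as (c & Hc & Hev); auto.
    specialize (Hmax c Hev). lra. }
  destruct (Req_dec a 1) as [-> | Hne]; [exact Hlevel | exfalso].
  destruct (no_intermediate_level f m A V a th0) as (c & Hc & Hev); auto; try lra.
  specialize (Hmax c Hev). lra.
Qed.

(** * Rescaling to unit cells and conclusion *)

Lemma is_derive_dilate (g : R -> R) (k x d : R) :
  is_derive g (k * x) d -> is_derive (fun z => g (k * z)) x (k * d).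
Proof.
  intros Hg. apply (is_derive_comp g (fun z => k * z)); [exact Hg |].
  auto_derive; [exact I | ring].
Qed.

Lemma cont3_dilate (g : R -> R -> R -> R) (l t x y : R) : 0 < l ->
  cont3 g (l * l * t) (l * x) (l * y) ->
  cont3 (fun t x y => g (l * l * t) (l * x) (l * y)) t x y.
Proof.
  intros Hl Hg eps Heps. destruct (Hg eps Heps) as (d & d0 & Hd).
  assert (Hscale : forall k z z', 0 < k -> Rabs (z' - z) < d / k ->
            Rabs (k * z' - k * z) < d).
  { intros k z z' Hk Hz. rewrite <- Rmult_minus_distr_l, Rabs_mult, (Rabs_pos_eq k) by lra.
    replace d with (k * (d / k)) by (field; lra). now apply Rmult_lt_compat_l. }
  assert (Hll : 0 < l * l) by nra.
  exists (Rmin (d / (l * l)) (d / l)).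
  pose proof (Rmin_l (d / (l * l)) (d / l)). pose proof (Rmin_r (d / (l * l)) (d / l)).
  split; [apply Rmin_glb_lt; apply Rdiv_lt_0_compat; lra |].
  intros t' x' y' Ht Hx Hy. apply Hd; apply Hscale; lra.
Qed.

(** Parabolic scaling: multiplying the equation by [l^2] turns [M] into [M l^2] and [A] into
    [A l]. *)
Lemma rescale_solution (M : R) (f : R -> R) (l A : R) (T0 : R -> R -> R)
    (T : R -> R -> R -> R) :
  0 < l ->
  (forall x y, 0 <= x <= PI * l -> 0 <= y <= PI * l -> T0 x y = 1) ->
  is_solution M f l A T0 T ->
  exists V, jv V = (fun t x y => T (l * l * t) (l * x) (l * y)) /\
    reaction_solution (M * (l * l)) f (A * l) V /\ ignited_cell V.
Proof.
  intros Hl HT0 (Hbd & Hper & _ & (Tt & Tx & Ty & Txx & Tyy & Heq) & Hinit).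
  assert (Hll : 0 < l * l) by nra.
  exists (Jet (fun t x y => T (l * l * t) (l * x) (l * y))
    (fun t x y => l * l * Tt (l * l * t) (l * x) (l * y))
    (fun t x y => l * Tx (l * l * t) (l * x) (l * y))
    (fun t x y => l * Ty (l * l * t) (l * x) (l * y))
    (fun t x y => l * (l * Txx (l * l * t) (l * x) (l * y)))
    (fun t x y => l * (l * Tyy (l * l * t) (l * x) (l * y)))).
  split; [reflexivity |]. split; [split; [| split] |].
  - intros t x y Ht. simpl.
    assert (Ht' : 0 < l * l * t) by (apply Rmult_lt_0_compat; lra).
    destruct (Heq (l * l * t) (l * x) (l * y) Ht')
      as (H1 & H2 & H3 & H4 & H5 & H6 & _).
    apply is_derive_Reals in H1, H2, H3, H4, H5.
    split; [exact (is_derive_dilate (fun s => T s (l * x) (l * y)) _ _ _ H1) |].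
    split; [exact (is_derive_dilate (fun z => T (l * l * t) z (l * y)) _ _ _ H2) |].
    split; [exact (is_derive_dilate (fun z => T (l * l * t) (l * x) z) _ _ _ H3) |].
    split.
    { apply (is_derive_scal (fun z => Tx (l * l * t) (l * z) (l * y))).
      exact (is_derive_dilate (fun z => Tx (l * l * t) z (l * y)) _ _ _ H4). }
    split.
    { apply (is_derive_scal (fun z => Ty (l * l * t) (l * x) (l * z))).
      exact (is_derive_dilate (fun z => Ty (l * l * t) (l * x) z) _ _ _ H5). }
    now apply cont3_dilate.
  - intros t x y Ht. simpl.
    rewrite <- (Hper (l * l * t) (l * x) (l * y)) by (apply Rmult_lt_0_compat; lra).
    f_equal. ring.
  - intros t x y Ht. simpl.
    assert (Ht' : 0 < l * l * t) by (apply Rmult_lt_0_compat; lra).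
    split; [now apply Hbd |].
    destruct (Heq (l * l * t) (l * x) (l * y) Ht')
      as (_ & _ & _ & _ & _ & _ & _ & _ & _ & _ & _ & E).
    unfold heat; simpl. unfold u1, u2 in E.
    replace (l * x / l) with x in E by (field; lra).
    replace (l * y / l) with y in E by (field; lra).
    transitivity (l * l * (M * f (T (l * l * t) (l * x) (l * y)))); [| ring].
    match type of E with _ = ?a + ?b + ?c => replace c with
      (Tt (l * l * t) (l * x) (l * y) + A * (sin x * cos y * Tx (l * l * t) (l * x) (l * y)
        + - (cos x * sin y) * Ty (l * l * t) (l * x) (l * y)) - a - b) by lra end.
    ring.
  - intros x y Hx Hy eps Heps. simpl.
    assert (Hx' : 0 < l * x < PI * l) by (split; nra).
    assert (Hy' : 0 < l * y < PI * l) by (split; nra).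
    assert (HT1 : T0 (l * x) (l * y) = 1) by (apply HT0; lra).
    destruct (interior_ball _ _ _ Hx') as (rx & Hrx & Hbx).
    destruct (interior_ball _ _ _ Hy') as (ry & Hry & Hby).
    (* The datum is constant near each point of the open cell, so the initial condition applies
       there. *)
    assert (Hc : cont2 T0 (l * x) (l * y)).
    { intros e He. exists (Rmin rx ry).
      pose proof (Rmin_l rx ry). pose proof (Rmin_r rx ry).
      split; [now apply Rmin_glb_lt |]. intros x' y' H1 H2.
      rewrite HT1, (HT0 x' y'), Rminus_diag, Rabs_R0; auto.
      - apply Hbx. lra.
      - apply Hby. lra. }
    destruct (Hinit (l * x) (l * y) ltac:(lra) Hc eps Heps) as (d & d0 & Hd).
    assert (Hdl : 0 < d / l) by (apply Rdiv_lt_0_compat; lra).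
    assert (Hdll : 0 < d / (l * l)) by (apply Rdiv_lt_0_compat; lra).
    exists (Rmin (d / l) (d / (l * l))).
    pose proof (Rmin_l (d / l) (d / (l * l))). pose proof (Rmin_r (d / l) (d / (l * l))).
    split; [now apply Rmin_glb_lt |]. intros t x' y' Ht H1 H2.
    assert (Hlt : forall z z', Rabs (z' - z) < d / l -> Rabs (l * z' - l * z) < d).
    { intros z z' Hz. rewrite <- Rmult_minus_distr_l, Rabs_mult, (Rabs_pos_eq l) by lra.
      replace d with (l * (d / l)) by (field; lra). now apply Rmult_lt_compat_l. }
    specialize (Hd (l * l * t) (l * x') (l * y')). rewrite HT1 in Hd.
    assert (Ht' : 0 < l * l * t < d).
    { split; [apply Rmult_lt_0_compat; lra |].
      replace d with (l * l * (d / (l * l))) by (field; lra).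
      apply Rmult_lt_compat_l; lra. }
    specialize (Hd Ht' (Hlt x x' ltac:(lra)) (Hlt y y' ltac:(lra))).
    apply Rabs_def2 in Hd. lra.
Qed.

Theorem theorem1 :
  forall f : R -> R, ignition f ->
  exists C1 C2 : R, 0 < C1 /\ 0 < C2 /\
    forall M : R, 0 < M ->
    exists l0 : R, C1 / sqrt M <= l0 <= C2 / sqrt M /\
      forall l : R, l0 <= l ->
      forall (A : R) (T0 : R -> R -> R) (T : R -> R -> R -> R),
        (forall x y, 0 <= T0 x y <= 1) ->
        (forall x y, 0 <= x <= PI * l -> 0 <= y <= PI * l -> T0 x y = 1) ->
        is_solution M f l A T0 T ->
        conv_to_one_loc_unif T.
Proof.
  intros f Hf. destruct (Hf) as (_ & _ & (th0 & Hth0 & _ & fpos) & _).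
  destruct (convergence_to_one f th0 Hf Hth0 fpos) as (m0 & Hm0 & Hconv).
  pose proof (sqrt_lt_R0 m0 Hm0) as Hs0.
  (* The requirement [m0 <= M l^2] reads [sqrt m0 / sqrt M <= l], so both constants can be
     [sqrt m0], fixed by [f] before [M] and [A] appear. *)
  exists (sqrt m0), (sqrt m0). split; [assumption |]. split; [assumption |].
  intros M HM. exists (sqrt m0 / sqrt M). split; [lra |].
  intros l Hl0 A T0 T _ HT1 Hsol.
  pose proof (sqrt_lt_R0 M HM) as HsM.
  assert (Hq : 0 < sqrt m0 / sqrt M) by (apply Rdiv_lt_0_compat; lra).
  assert (Hl : 0 < l) by lra.
  assert (Hm : m0 <= M * (l * l)).
  { rewrite <- (sqrt_sqrt m0), <- (sqrt_sqrt M) by lra.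
    assert (sqrt m0 <= sqrt M * l).
    { replace (sqrt m0) with (sqrt M * (sqrt m0 / sqrt M)) by (field; lra).
      apply Rmult_le_compat_l; lra. }
    replace (sqrt M * sqrt M * (l * l)) with (sqrt M * l * (sqrt M * l)) by ring.
    apply Rmult_le_compat; lra. }
  destruct (rescale_solution M f l A T0 T Hl HT1 Hsol) as (V & HVT & HR & Hign).
  intros Rb eps HRb Heps.
  destruct (Hconv _ _ V Hm HR Hign (1 - eps) (Rb / l) ltac:(lra)) as (t1 & Ht1 & H1).
  assert (Hll : 0 < l * l) by nra.
  exists (l * l * t1). intros t x y Ht Hx Hy.
  assert (Ht0 : 0 < t) by (pose proof (Rmult_lt_0_compat _ _ Hll Ht1); lra).
  destruct Hsol as (Hbd & _). specialize (Hbd t x y Ht0).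
  specialize (H1 (t / (l * l)) (x / l) (y / l)). rewrite HVT in H1.
  replace (l * l * (t / (l * l))) with t in H1 by (field; lra).
  replace (l * (x / l)) with x in H1 by (field; lra).
  replace (l * (y / l)) with y in H1 by (field; lra).
  assert (Hgt : 1 - eps < T t x y).
  { apply H1.
    - apply Rle_div_r; lra.
    - apply Rabs_le_between in Hx. split.
      + replace (- (Rb / l)) with (- Rb / l) by (field; lra).
        apply Rmult_le_compat_r; [left; apply Rinv_0_lt_compat |]; lra.
      + apply Rmult_le_compat_r; [left; apply Rinv_0_lt_compat |]; lra. }
  apply Rabs_def1; lra.
Qed.
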